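(* Let $\ell$ be a real number with $\ell\geq 1+\frac{4}{N}$ and $\ell\geq 2$. Let $f:\mathbb{R}\to\mathbb{R}$ satisfy $f(0)=0$ and $$|f(u)-f(v)|\leq C|u-v|\big(|u|^{\ell-1}e^{\lambda u^2}+|v|^{\ell-1}e^{\lambda v^2}\big)\quad\text{for all }u,v\in\mathbb{R},$$ for some constants $C>0$, $\lambda>0$. Let $u_0\in\exp L^2_0(\mathbb{R}^N)$ with $\|u_0\|_{\exp L^2}$ sufficiently small, and let $u\in C([0,\infty);\exp L^2_0(\mathbb{R}^N))$ be the global solution of $$\partial_t u-\Delta u=f(u),\quad t>0,\ x\in\mathbb{R}^N,\qquad u(0)=u_0.$$ Then there exists $C>0$ such that $\|u(t)\|_{L^p}\leq C\,t^{-\sigma}$ for all $t>0$, where $\sigma=\frac{1}{\ell-1}-\frac{N}{2p}>0$, with $\frac{N(\ell-1)}{2}<p<\infty$ if $N\geq 4$, and $\max\{\ell,\frac{2N(\ell-1)}{4-N}\}\leq p\leq\infty$ if $N<4$.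
   Context: The Orlicz space $\exp L^2(\mathbb{R}^N)$ is the set of $u\in L^1_{loc}(\mathbb{R}^N)$ such that $\int_{\mathbb{R}^N}(e^{|u(x)|^2/\alpha^2}-1)\,dx<\infty$ for some $\alpha>0$, with the Luxemburg norm $\|u\|_{\exp L^2}=\inf\{\alpha>0:\int_{\mathbb{R}^N}(e^{|u(x)|^2/\alpha^2}-1)\,dx\leq 1\}$; $\exp L^2_0(\mathbb{R}^N)$ is the closure of $C_0^\infty(\mathbb{R}^N)$ in this norm. For such $f$ and $\|u_0\|_{\exp L^2}$ small, the heat equation above has a global solution $u\in C([0,\infty);\exp L^2_0)$ satisfying $u(t)=e^{t\Delta}u_0+\int_0^t e^{(t-s)\Delta}f(u(s))\,ds$, where $e^{t\Delta}$ is the heat semigroup. *)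

(* Defs.v *)
From HB Require Import structures.
From mathcomp Require Import all_boot all_order all_algebra.
From mathcomp Require Import all_classical all_reals all_analysis.
Set Implicit Arguments. Unset Strict Implicit. Unset Printing Implicit Defensive.
Import Order.TTheory GRing.Theory Num.Theory.
Import numFieldNormedType.Exports.
Local Open Scope classical_set_scope.
Local Open Scope ring_scope.

Section Defs.
Variables (R : realType) (N : nat).

(* The ambient space R^N is modelled as N.-tuple R (with the product sigma-algebra
   generated by the coordinate projections, from measurable_structure.v). *)
Definition sqdist (x y : N.-tuple R) : R :=
  \sum_(i < N) (tnth x i - tnth y i) ^+ 2.

Definition is_lebesgue_measure (mu : {measure set (N.-tuple R) -> \bar R}) :=
  forall a b : N.-tuple R, (forall i, tnth a i <= tnth b i) ->
    mu [set x | forall i, tnth a i <= tnth x i <= tnth b i] =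
    (\prod_(i < N) (tnth b i - tnth a i))%:E.

Variable mu : {measure set (N.-tuple R) -> \bar R}.

Definition L1loc (u : N.-tuple R -> R) :=
  measurable_fun setT u /\
  forall r : R, 0 < r -> mu.-integrable [set x | forall i, `|tnth x i| <= r] (EFin \o u).

Definition orlicz_modular (u : N.-tuple R -> R) (a : R) : \bar R :=
  (\int[mu]_x (expR (u x ^+ 2 / a ^+ 2) - 1)%:E)%E.

Definition in_expL2 (u : N.-tuple R -> R) :=
  L1loc u /\ exists a : R, 0 < a /\ (orlicz_modular u a < +oo)%E.

Definition expL2_norm (u : N.-tuple R -> R) : R :=
  inf [set a : R | 0 < a /\ (orlicz_modular u a <= 1)%E].

Definition tuple_of_rv (v : 'rV[R]_N) : N.-tuple R := [tuple v ord0 i | i < N].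

Fixpoint Ck (k : nat) (g : 'rV[R]_N -> R) : Prop :=
  match k with
  | 0%N => continuous g
  | k'.+1 => continuous g /\ (forall x v, derivable g x v) /\
             forall v, Ck k' (fun x => derive g x v)
  end.

Definition smooth (g : 'rV[R]_N -> R) := forall k, Ck k g.

Definition C0infty (phi : N.-tuple R -> R) :=
  smooth (phi \o tuple_of_rv) /\
  compact (closure [set v | (phi \o tuple_of_rv) v != 0]).

Definition in_expL2_0 (u : N.-tuple R -> R) :=
  in_expL2 u /\
  forall e : R, 0 < e -> exists phi, C0infty phi /\ expL2_norm (u \- phi) < e.

Definition heat (t : R) (g : N.-tuple R -> R) (x : N.-tuple R) : R :=
  if t == 0 then g x else
  Rintegral mu setT (fun y =>
    (4 * pi * t) `^ (- (N%:R / 2)) * expR (- sqdist x y / (4 * t)) * g y).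

Definition continuous_expL2_0 (u : R -> N.-tuple R -> R) :=
  (forall t, 0 <= t -> in_expL2_0 (u t)) /\
  forall t, 0 <= t -> forall e : R, 0 < e -> exists2 d : R, 0 < d &
    forall s, 0 <= s -> `|s - t| < d -> expL2_norm (u s \- u t) < e.

Definition global_mild_solution (f : R -> R) (u0 : N.-tuple R -> R)
    (u : R -> N.-tuple R -> R) :=
  continuous_expL2_0 u /\
  (forall t, 0 <= t ->
    {ae mu, forall x, u t x = heat t u0 x +
       Rintegral lebesgue_measure `[0, t]
         (fun s => heat (t - s) (f \o u s) x)}).

Definition decay_rate (l : R) (p : \bar R) : R :=
  match p with
  | EFin r => 1 / (l - 1) - N%:R / (2 * r)
  | _ => 1 / (l - 1)
  end.

End Defs.

(* Main.v *)
(** The solution is shown to stay in a small class by a continuity argument; no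
    fixed point is needed, because a mild solution that is continuous in exp L^2
    has finite and continuous norms a priori.

    Put m = 1 + 4/N, the L^2-critical power. Since m <= l, the nonlinearity obeys
    |f(x)| <= C |x|^m exp(k x^2), so the problem reduces to this exponent, and one
    can propagate the decay of the linear heat flow of an L^2 function: with
    w(t) = eps (1 + t)^(-N/4), a fixed large P and all t,
      int (exp(u^2/eps^2) - 1) <= 1   and   int |u|^P <= eps^2 w(t)^(P-2).
    The class gives int |u|^q exp(k u^2) <= C eps^2 w^(q-2) for 2 <= q <= P/2, by
    pointwise Young inequalities. Hence f(u(s)) is O(eps^m (1+s)^(-3/4)) in
    L^(2N/(N+1)) and O(eps^m (1+s)^(-N/4-1/2)) in L^N, and the smoothing of the
    heat semigroup bounds the Duhamel term by O(eps^m) in L^2 and by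
    O(eps^m (1+t)^(-N/4)) in L^oo. As m > 1, for eps small these bounds improve the
    class by a fixed factor, and the class propagates to all times. Its decay rate
    N/4 - N/(2p) is at least sigma because l >= m.

    Only the measure of cubes enters: the mass of the Gaussian kernel is bounded,
    not computed, and Jensen's inequality for kernels of bounded mass replaces the
    contraction properties of the semigroup. *)
Require Import Defs.
From HB Require Import structures.
From mathcomp Require Import all_boot all_order all_algebra.
From mathcomp Require Import all_classical all_reals all_analysis.
From mathcomp Require Import measurable_realfun.
From mathcomp Require Import ring lra.
Import Order.TTheory GRing.Theory Num.Theory.
Import numFieldNormedType.Exports.
Local Open Scope classical_set_scope.
Local Open Scope ring_scope.
Set Implicit Arguments. Unset Strict Implicit. Unset Printing Implicit Defensive.

(** * Young functions and Jensen's inequality *)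

(** The sup norm cannot carry the continuity argument: along a path in exp L^2 it need be neither
    finite nor continuous. Every L^P norm with 2 <= P < oo is both, because exp L^2 embeds in L^P;
    hence a class with one large finite P. The bound 2 (N + 4) <= P comes from putting |u|^m exp(k
    u^2) into L^N, which produces |u|^(N+4), and from doubling that power when Young's inequality
    splits off the exponential. The exponents 2N/(N+1) and N give the semigroup a singularity
    integrable in every dimension: (t-s)^(-1/4) from the first to L^2, (t-s)^(-1/2) from the second
    to L^oo. As m is critical, the exponents 1/4 and 3/4 of the L^2 estimate add up to exactly 1, so
    its time integral is bounded by a constant independent of t. For p = oo the class is not enough.
    The Duhamel term already has a sup bound; the linear part is estimated on its own, from an L^q
    norm of u_0 for t <= 1 and from its L^2 norm afterwards. *)

Definition young {R : realType} (phi : R -> R) :=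
  phi 0 = 0 /\ forall z0, 0 <= z0 -> exists2 c, 0 <= c &
    forall z, 0 <= z -> phi z0 + c * (z - z0) <= phi z.

Definition Phi {R : realType} (x : R) : R := expR (x ^+ 2) - 1.

Section young.
Context {R : realType}.
Implicit Types (phi : R -> R) (x y z : R).

Lemma young_ge0 phi z : young phi -> 0 <= z -> 0 <= phi z.
Proof.
move=> [phi0 H] z0; have [c c0 /(_ z z0)] := H 0 (lexx 0).
by rewrite phi0 subr0 add0r; apply: le_trans; rewrite mulr_ge0.
Qed.

Lemma young_le phi x y : young phi -> 0 <= x -> x <= y -> phi x <= phi y.
Proof.
move=> [_ H] x0 xy; have [c c0 /(_ y (le_trans x0 xy))] := H x x0.
by apply: le_trans; rewrite lerDl mulr_ge0// subr_ge0.
Qed.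

Lemma young_convex phi a b x y : young phi -> 0 <= a -> 0 <= b -> a + b = 1 ->
  0 <= x -> 0 <= y -> phi (a * x + b * y) <= a * phi x + b * phi y.
Proof.
move=> [_ H] a0 b0 ab x0 y0.
have z0 : 0 <= a * x + b * y by rewrite addr_ge0 ?mulr_ge0.
have [c c0 Hc] := H _ z0.
have h1 := ler_wpM2l a0 (Hc x x0).
have h2 := ler_wpM2l b0 (Hc y y0).
apply: le_trans (lerD h1 h2).
have -> : b = 1 - a by rewrite -ab addrC addKr.
rewrite le_eqVlt; apply/orP; left; apply/eqP; ring.
Qed.

Lemma young_scale phi a x : young phi -> 0 <= a <= 1 -> 0 <= x ->
  phi (a * x) <= a * phi x.
Proof.
move=> yphi /andP[a0 a1] x0.
have b0 : 0 <= 1 - a by rewrite subr_ge0.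
have := young_convex yphi a0 b0 (subrKC a 1) x0 (lexx 0).
by rewrite mulr0 addr0 yphi.1 mulr0 addr0.
Qed.

(** Multiplied by q, Young's inequality for z and z0^(q-1) with exponents q and q/(q-1) is exactly
    the tangent line inequality at z0. The case q = 1 has no finite conjugate exponent and is
    linear. *)
Lemma young_powR (q : R) : 1 <= q -> young (fun z => z `^ q).
Proof.
move=> q1; have q0 : 0 < q by rewrite (lt_le_trans _ q1).
split; first by rewrite powR0// gt_eqF.
move=> z0 z00; exists (q * z0 `^ (q - 1)) => [|z zge0].
  by rewrite mulr_ge0 ?powR_ge0// ltW.
move: q1; rewrite le_eqVlt => /predU1P[<-|q1].
  by rewrite subrr powRr0 mul1r mul1r !powRr1// subrKC.
have q10 : 0 < q - 1 by rewrite subr_gt0.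
have qq : z0 `^ (q - 1) * z0 = z0 `^ q.
  rewrite -[X in _ * X](powRr1 z00) -powRD; first by rewrite subrK.
  by rewrite subrK gt_eqF.
have := @conjugate_powR _ z (z0 `^ (q - 1)) q (q / (q - 1)) zge0 (powR_ge0 _ _).
rewrite divr_gt0// => /(_ q0 isT).
rewrite -powRrM mulrCA divff ?gt_eqF// mulr1 invf_div.
have -> : q^-1 + (q - 1) / q = 1 by field; rewrite gt_eqF.
move=> /(_ erefl); rewrite -(ler_pM2l q0) => h.
rewrite mulrBr -mulrA -mulrA qq.
have e : q * (z `^ q / q + z0 `^ q * ((q - 1) / q)) = z `^ q + (q - 1) * z0 `^ q.
  by field; rewrite gt_eqF.
move: h; rewrite e => h; nra.
Qed.

Lemma young_sqr : young (fun z : R => z ^+ 2).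
Proof.
split; first by rewrite expr0n.
move=> z0 z00; exists (2 * z0) => [|z zge0]; first by rewrite mulr_ge0.
by have := sqr_ge0 (z - z0); nra.
Qed.

Lemma young_Phi : young (@Phi R).
Proof.
split; first by rewrite /Phi expr0n/= expR0 subrr.
move=> z0 z00; exists (expR (z0 ^+ 2) * (2 * z0)) => [|z zge0].
  by rewrite !mulr_ge0 ?expR_ge0.
rewrite /Phi.
have -> : z ^+ 2 = z0 ^+ 2 + (z ^+ 2 - z0 ^+ 2) by ring.
rewrite expRD; have E := expR_gt0 (z0 ^+ 2).
have h1 := expR_ge1Dx (z ^+ 2 - z0 ^+ 2).
have h2 := sqr_ge0 (z - z0).
have : 1 + 2 * z0 * (z - z0) <= expR (z ^+ 2 - z0 ^+ 2) by nra.
move/(ler_wpM2l (ltW E)); nra.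
Qed.

End young.

(** * Tonelli's theorem when sigma-finiteness is a hypothesis *)

Section sigma_finite_tonelli.
Context d (T : measurableType d) (R : realType) (mu : {measure set T -> \bar R}).
Hypothesis h : sigma_finite setT mu.
(** An alias of [mu] that carries the proof of sigma-finiteness, so that a sigma-finite structure
    can be attached to it. *)
Definition sfm_of (_ : sigma_finite setT mu) : set T -> \bar R := mu.
HB.instance Definition _ := Measure.on (sfm_of h).
HB.instance Definition _ := @Measure_isSigmaFinite.Build d T R (sfm_of h) h.
Definition sfm : {sigma_finite_measure set T -> \bar R} := sfm_of h.

Local Open Scope ereal_scope.

Lemma measurable_fun_integral_pos d1 (T1 : measurableType d1) (F : T1 * T -> \bar R) :
  measurable_fun setT F -> (forall z, 0 <= F z) ->
  measurable_fun setT (fun x => \int[mu]_y F (x, y)).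
Proof. exact: (@measurable_fun_fubini_tonelli_F _ _ T1 T R sfm). Qed.

Lemma measurable_fun_integral d1 (T1 : measurableType d1) (F : T1 * T -> \bar R) :
  measurable_fun setT F ->
  measurable_fun setT (fun x => \int[mu]_y F (x, y)).
Proof.
move=> mF.
rewrite [X in measurable_fun _ X](_ : _ = (fun x => \int[mu]_y F^\+ (x, y) -
    \int[mu]_y F^\- (x, y))); last first.
  apply/funext => x; rewrite integralE.
  by congr (_ - _)%E; apply: eq_integral => y _; rewrite ?funeposE ?funenegE.
apply: emeasurable_funB; apply: measurable_fun_integral_pos => //.
- exact: measurable_funepos.
- exact: measurable_funeneg.
Qed.

Lemma measurable_fun_Rintegral d1 (T1 : measurableType d1) (F : T1 * T -> R) :
  measurable_fun setT F ->
  measurable_fun setT (fun x => Rintegral mu setT (fun y => F (x, y))).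
Proof.
move=> mF; apply: measurableT_comp => //.
by apply: (measurable_fun_integral (F := EFin \o F)); exact/measurable_EFinP.
Qed.

End sigma_finite_tonelli.

Lemma tonelli_sf d1 (T1 : measurableType d1) d (T : measurableType d) (R : realType)
  (nu : {measure set T1 -> \bar R}) (mu : {measure set T -> \bar R})
  (F : T1 * T -> \bar R) : sigma_finite setT nu -> sigma_finite setT mu ->
  measurable_fun setT F -> (forall z, 0 <= F z)%E ->
  (\int[nu]_x \int[mu]_y F (x, y) = \int[mu]_y \int[nu]_x F (x, y))%E.
Proof.
move=> snu smu.
exact: (@fubini_tonelli _ _ T1 T R (sfm snu) (sfm smu)).
Qed.

(** * Integrals of nonnegative real-valued functions *)

Section real_integral.
Context d (T : measurableType d) (R : realType) (mu : {measure set T -> \bar R}).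
Variables (D : set T) (mD : measurable D).
Implicit Types f g : T -> R.
Local Open Scope ereal_scope.

Lemma real_integral_le f g : measurable_fun D f -> measurable_fun D g ->
  (forall x, D x -> (0 <= f x)%R) -> (forall x, D x -> (f x <= g x)%R) ->
  \int[mu]_(x in D) (f x)%:E <= \int[mu]_(x in D) (g x)%:E.
Proof.
move=> mf mg f0 fg; apply: ge0_le_integral => //; try exact/measurable_EFinP.
Qed.

Lemma real_integralD f g : measurable_fun D f -> measurable_fun D g ->
  (forall x, D x -> (0 <= f x)%R) -> (forall x, D x -> (0 <= g x)%R) ->
  \int[mu]_(x in D) (f x + g x)%:E =
  \int[mu]_(x in D) (f x)%:E + \int[mu]_(x in D) (g x)%:E.
Proof.
move=> mf mg f0 g0; under eq_integral do rewrite EFinD.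
by apply: ge0_integralD => //; exact/measurable_EFinP.
Qed.

Lemma real_integralZ (k : R) f : measurable_fun D f -> (0 <= k)%R ->
  (forall x, D x -> (0 <= f x)%R) ->
  \int[mu]_(x in D) (k * f x)%:E = k%:E * \int[mu]_(x in D) (f x)%:E.
Proof.
move=> mf k0 f0; under eq_integral do rewrite EFinM.
by apply: ge0_integralZl => //; exact/measurable_EFinP.
Qed.

Lemma real_integral_ge0 f : (forall x, D x -> (0 <= f x)%R) ->
  0 <= \int[mu]_(x in D) (f x)%:E.
Proof. by move=> f0; apply: integral_ge0 => x Dx; rewrite lee_fin f0. Qed.

End real_integral.

Section jensen.
Context d (T : measurableType d) (R : realType) (mu : {measure set T -> \bar R}).
Variables (D : set T) (mD : measurable D).

Lemma le_normr_Rintegral_ge0 (f : T -> R) : measurable_fun D f ->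
  (`|Rintegral mu D f|%:E <= \int[mu]_(x in D) `|f x|%:E)%E.
Proof.
move=> /measurable_EFinP mf; have := le_abse_integral mu mD mf.
rewrite /Rintegral /comp /=; apply: le_trans.
by case: (integral _ _ _) => [r| |]//=; rewrite normr0 leey.
Qed.

(* A non-integrable [f] gives the junk value 0, so the bounds on [Rintegral] below
   need no integrability hypothesis. *)
Lemma Rintegral_infty (f : T -> R) : measurable_fun D f ->
  (\int[mu]_(x in D) `|f x|%:E = +oo)%E -> Rintegral mu D f = 0.
Proof.
move=> mf.
have mF : measurable_fun D (EFin \o f) by exact/measurable_EFinP.
under eq_integral do rewrite -abse_EFin.
rewrite -[X in integral _ _ X]/(abse \o (EFin \o f)) fune_abse ge0_integralD//=; last 2 first.
- exact: measurable_funepos.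
- exact: measurable_funeneg.
rewrite /Rintegral [X in _ -> fine X = _]integralE.
have := @integral_ge0 _ _ _ mu D ((EFin \o f)^\+)%E (fun x _ => funepos_ge0 _ x).
have := @integral_ge0 _ _ _ mu D ((EFin \o f)^\-)%E (fun x _ => funeneg_ge0 _ x).
by case: (integral _ _ _) => [r| |]//=; case: (integral _ _ _) => [s| |].
Qed.

(** The support line of [phi] at q = (integral of |k g|) / M, integrated against [k]. The mass of
    [k] may fall short of M: since [phi 0 = 0], the line has intercept phi q - c q <= 0, so
    replacing the true mass by M only lowers the bound. *)
Lemma jensen (phi : R -> R) (M : R) (k g : T -> R) : young phi -> 0 < M ->
  measurable_fun setT phi -> measurable_fun D k -> measurable_fun D g ->
  (forall x, D x -> 0 <= k x) -> (\int[mu]_(x in D) (k x)%:E <= M%:E)%E ->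
  ((M * phi (`|Rintegral mu D (fun x => k x * g x)| / M))%:E <=
     \int[mu]_(x in D) (k x * phi `|g x|)%:E)%E.
Proof.
move=> yphi M0 mphi mk mg k0 k1.
have mkg : measurable_fun D (fun x => k x * g x) by exact: measurable_funM.
have mpg : measurable_fun D (fun x => phi `|g x|).
  by apply: (measurableT_comp mphi); exact: measurableT_comp.
have mkpg : measurable_fun D (fun x => k x * phi `|g x|) by exact: measurable_funM.
have mng : measurable_fun D (fun x => `|g x|) by exact: measurableT_comp.
have pg0 x : 0 <= phi `|g x| by exact: young_ge0.
have J0 : (0 <= \int[mu]_(x in D) (k x * phi `|g x|)%:E)%E.
  by apply: integral_ge0 => x Dx; rewrite lee_fin mulr_ge0// k0.
have := le_normr_Rintegral_ge0 mkg.
have : (0 <= \int[mu]_(x in D) `|k x * g x|%:E)%E by exact: integral_ge0.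
case I : (\int[mu]_(x in D) `|k x * g x|%:E)%E => [r| |]//; last first.
  by rewrite (Rintegral_infty mkg I) normr0 mul0r yphi.1 mulr0.
rewrite !lee_fin => r0 Ir.
have Mi : 0 < M^-1 by rewrite invr_gt0.
pose q := r / M.
have q0 : 0 <= q by rewrite divr_ge0// ltW.
have rq : r = M * q by rewrite /q; field; rewrite gt_eqF.
apply: (@le_trans _ _ (M * phi q)%:E).
  by rewrite lee_fin ler_wpM2l ?(ltW M0)// (young_le yphi) ?ler_wpM2r ?divr_ge0// ltW.
have [c c0 Hc] := yphi.2 q q0.
have phiq : phi q <= c * q.
  by have := Hc 0 (lexx _); rewrite yphi.1 sub0r mulrN subr_le0.
have : (0 <= \int[mu]_(x in D) (k x)%:E)%E by apply: integral_ge0.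
case K : (\int[mu]_(x in D) (k x)%:E)%E k1 => [s| |]//; rewrite !lee_fin => s1 s0.
have phiq0 : 0 <= phi q by exact: young_ge0.
have cq0 : 0 <= c * q by exact: mulr_ge0.
have m1 : measurable_fun D (fun x => phi q * k x) by exact: measurable_funM.
have m2 : measurable_fun D (fun x => `|k x * g x|) by exact: measurableT_comp.
have m2' : measurable_fun D (fun x => c * `|k x * g x|) by exact: measurable_funM.
have m3 : measurable_fun D (fun x => c * q * k x) by exact: measurable_funM.
have n1 x : D x -> 0 <= phi q * k x by move=> Dx; rewrite mulr_ge0 ?k0.
have n2 x : D x -> 0 <= c * `|k x * g x| by move=> Dx; rewrite mulr_ge0.
have n3 x : D x -> 0 <= c * q * k x by move=> Dx; rewrite mulr_ge0 ?k0.
have n4 x : D x -> 0 <= k x * phi `|g x| by move=> Dx; rewrite mulr_ge0 ?k0.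
(* The negative part of the support line is moved to the right, so that both integrands are
   nonnegative and the integrals split without integrability conditions. *)
have : (\int[mu]_(x in D) (phi q * k x + c * `|k x * g x|)%:E <=
        \int[mu]_(x in D) (k x * phi `|g x| + (c * q) * k x)%:E)%E.
  apply: real_integral_le => //.
  - exact: measurable_funD.
  - exact: measurable_funD.
  - by move=> x Dx; rewrite addr_ge0// ?n1 ?n2.
  - move=> x Dx; rewrite normrM (ger0_norm (k0 _ Dx)).
    by have := ler_wpM2l (k0 _ Dx) (Hc `|g x| (normr_ge0 _)); nra.
rewrite !real_integralD ?real_integralZ//.
rewrite K I.
case: (integral _ _ _) J0 => [j| |]//=; last by move=> *; rewrite leey.
rewrite -!EFinM -!EFinD !lee_fin rq => j0 h; nra.
Qed.
End jensen.

(** * The Gaussian kernel *)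

Definition gauss_kernel {R : realType} {N : nat} (t : R) (x y : N.-tuple R) : R :=
  (4 * pi * t) `^ (- (N%:R / 2)) * expR (- sqdist x y / (4 * t)).

Section gauss_kernel.
Context {R : realType} {N : nat}.
Implicit Types (t : R) (x y : N.-tuple R).

Lemma heatE (mu : {measure set (N.-tuple R) -> \bar R}) t g x : t != 0 ->
  heat mu t g x = Rintegral mu setT (fun y => gauss_kernel t x y * g y).
Proof. by rewrite /heat => /negbTE ->. Qed.

Lemma sqdistC x y : sqdist x y = sqdist y x.
Proof. by apply: eq_bigr => i _; rewrite -sqrrN opprB. Qed.

Lemma sqdist_ge0 x y : 0 <= sqdist x y.
Proof. by apply: sumr_ge0 => i _; exact: sqr_ge0. Qed.

Lemma gauss_kernelC t x y : gauss_kernel t x y = gauss_kernel t y x.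
Proof. by rewrite /gauss_kernel sqdistC. Qed.

Lemma gauss_kernel_ge0 t x y : 0 <= gauss_kernel t x y.
Proof. by rewrite mulr_ge0 ?powR_ge0 ?expR_ge0. Qed.

Lemma powR_neg_le (a b q : R) : 0 < a -> a <= b -> 0 <= q -> b `^ (- q) <= a `^ (- q).
Proof.
move=> a0 ab q0; rewrite !powRN lef_pV2 ?posrE ?powR_gt0//; last exact: lt_le_trans ab.
by rewrite ge0_ler_powR ?nnegrE// ltW// (lt_le_trans a0).
Qed.

Lemma gauss_kernel_le t x y : 0 < t -> gauss_kernel t x y <= t `^ (- (N%:R / 2)).
Proof.
move=> t0; rewrite -[leRHS]mulr1 ler_pM ?powR_ge0 ?expR_ge0//.
  apply: powR_neg_le => //.
  have := pi_ge2 R; nra.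
by rewrite expR_le1 mulNr oppr_le0 divr_ge0 ?sqdist_ge0// mulr_ge0// ltW.
Qed.

Lemma measurable_sqdist d (T : measurableType d) (f g : T -> N.-tuple R) :
  measurable_fun setT f -> measurable_fun setT g ->
  measurable_fun setT (fun z => sqdist (f z) (g z)).
Proof.
move=> mf mg; apply: measurable_sum => i; apply: measurable_funX.
by apply: measurable_funB; apply: (measurableT_comp (measurable_tnth i)).
Qed.

Lemma measurable_gauss_kernel d (T : measurableType d) (s : T -> R)
    (f g : T -> N.-tuple R) : (forall z, 0 <= s z) -> measurable_fun setT s ->
  measurable_fun setT f -> measurable_fun setT g ->
  measurable_fun setT (fun z => gauss_kernel (s z) (f z) (g z)).
Proof.
move=> s0 ms mf mg.
(* Division is rewritten as the power -1, which agrees with the inverse at 0 too; so [s] may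
   vanish. *)
rewrite [X in measurable_fun _ X](_ : _ = fun z => (4 * pi * s z) `^ (- (N%:R / 2)) *
   expR (- sqdist (f z) (g z) * (4 * s z) `^ (- 1))); last first.
  by apply/funext => z; rewrite powR_inv1 ?mulr_ge0.
apply: measurable_funM.
  by apply: (measurableT_comp (measurable_powR _)); exact: measurable_funM.
apply: measurableT_comp => //; apply: measurable_funM.
  by apply: measurableT_comp => //; exact: measurable_sqdist.
by apply: (measurableT_comp (measurable_powR _)); exact: measurable_funM.
Qed.

Definition cube (c : N.-tuple R) (r : R) : set (N.-tuple R) :=
  [set x | forall i, tnth c i - r <= tnth x i <= tnth c i + r].

Lemma measurable_cube c r : measurable (cube c r).
Proof.
rewrite (_ : cube c r = \bigcap_(i in [set: 'I_N])
    ((fun x => tnth x i) @^-1` `[tnth c i - r, tnth c i + r])); last first.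
  by apply/seteqP; split => [x /= h i _|x /= h i]; have := h i; rewrite /= in_itv//=; apply.
apply: fin_bigcap_measurable => // i _.
rewrite -[X in measurable X]setTI; apply: measurable_tnth => //.
Qed.

Section lebesgue.
Variable mu : {measure set (N.-tuple R) -> \bar R}.
Hypothesis mu_leb : is_lebesgue_measure mu.

Lemma lebesgue_cube c r : 0 <= r -> mu (cube c r) = ((2 * r) ^+ N)%:E.
Proof.
move=> r0.
pose a := [tuple tnth c i - r | i < N]; pose b := [tuple tnth c i + r | i < N].
have := mu_leb (a := a) (b := b).
rewrite (_ : [set x | _] = cube c r); last first.
  by apply/seteqP; split => x /= h i; have := h i; rewrite !tnth_mktuple.
move=> ->; last by move=> i; rewrite !tnth_mktuple; lra.
congr EFin; rewrite -[N in RHS]card_ord -prodr_const; apply: eq_bigr => i _.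
by rewrite !tnth_mktuple; ring.
Qed.

Lemma lebesgue_sigma_finite : sigma_finite setT mu.
Proof.
pose o : N.-tuple R := [tuple 0 | i < N].
exists (fun n : nat => cube o n%:R); last first.
  by move=> n; split; [exact: measurable_cube|rewrite lebesgue_cube// ltry].
apply/seteqP; split => // x _.
exists (\sum_(i < N) (Num.truncn `|tnth x i|).+1)%N => // i.
rewrite tnth_mktuple sub0r add0r -ler_norml.
apply: (@le_trans _ _ ((Num.truncn `|tnth x i|).+1)%:R).
  by rewrite ltW// truncnS_gt.
by rewrite ler_nat (bigD1 i)//= leq_addr.
Qed.

(** The N-th power of x/N <= exp(x/N). It absorbs the polynomial growth of the cube volumes. *)
Lemma pow_le_expR (x : R) : (0 < N)%N -> 0 <= x -> x ^+ N <= N%:R ^+ N * expR x.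
Proof.
move=> N0 x0; have N0' : 0 < N%:R :> R by rewrite ltr0n.
have -> : expR x = expR (x / N%:R) ^+ N.
  by rewrite -expRM_natr divfK// gt_eqF.
rewrite -exprMn lerXn2r ?nnegrE ?mulr_ge0 ?expR_ge0//.
rewrite -ler_pdivrMl// mulrC.
by apply: le_trans (expR_ge1Dx _); rewrite lerDr.
Qed.

(* The kernel is dominated by a step function: on the shell between the cubes of
   half-side k sqrt t and (k+1) sqrt t its exponential factor is at most e^(-k^2/4). *)
Lemma gauss_kernel_mass : (0 < N)%N -> exists2 M : R, 1 <= M &
  forall t x, 0 < t -> (\int[mu]_y (gauss_kernel t x y)%:E <= M%:E)%E.
Proof.
move=> N0; pose z : R := expR (- 1).
have z1 : z < 1 by rewrite expR_lt1 oppr_lt0.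
have z0 : 0 < z by exact: expR_gt0.
(* The k-th term is at most N^N exp(k + 1 - k^2/4), and (k/2 - 2)^2 >= 0 gives k + 1 - k^2/4 <= 5 -
   k: a geometric series of ratio 1/e and first term A. *)
pose A : R := N%:R ^+ N * expR 5.
have A0 : 0 <= A by rewrite mulr_ge0 ?expR_ge0.
exists (Num.max 1 (A / (1 - z))); first by rewrite le_max lexx.
move=> t x t0.
have st0 : 0 < Num.sqrt t by rewrite sqrtr_gt0.
pose P := (4 * pi * t) `^ (- (N%:R / 2)).
have P0 : 0 <= P by exact: powR_ge0.
pose c (k : nat) : R := P * expR (- (k%:R ^+ 2 / 4)).
have c0 k : 0 <= c k by rewrite mulr_ge0 ?expR_ge0.
pose C k := cube x (k.+1%:R * Num.sqrt t).
have mC k : measurable (C k) by exact: measurable_cube.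
have mF k : measurable_fun setT (fun y => (c k * \1_(C k) y)%:E).
  by apply/measurable_EFinP/measurable_funM => //; exact: measurable_indic.
have F0 k y : (0 <= (c k * \1_(C k) y)%:E)%E by rewrite lee_fin mulr_ge0.
apply: (@le_trans _ _ (\int[mu]_y \sum_(0 <= k <oo) (c k * \1_(C k) y)%:E)%E).
  apply: ge0_le_integral => //.
  - by move=> y _; rewrite lee_fin gauss_kernel_ge0.
  - apply/measurable_EFinP; apply: measurable_gauss_kernel => //.
    by move=> _; exact: ltW.
  - by apply: ge0_emeasurable_sum.
  move=> y _.
  have [k yk] : exists k, y \in C k.
    exists (\sum_(i < N) (Num.truncn (`|tnth y i - tnth x i| / Num.sqrt t)%R))%N.
    rewrite inE => i; rewrite -ler_distl -ler_pdivrMr//.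
    apply: (@le_trans _ _ ((Num.truncn (`|tnth y i - tnth x i| / Num.sqrt t)).+1)%:R).
      by rewrite ltW// truncnS_gt.
    by rewrite ler_nat ltnS (bigD1 i)//= leq_addr.
  (* For the least such k, y lies outside the previous cube, so some coordinate of y - x exceeds k
     sqrt t. *)
  have [{k}k {}yk kmin] := @ex_minnP (fun k => y \in C k) (ex_intro _ k yk).
  apply: (@le_trans _ _ (c k * \1_(C k) y)%:E); last first.
    apply: le_trans (@nneseries_lim_ge R _ xpredT 0 k.+1 _) => //.
    by rewrite big_nat_recr//= leeDr// sume_ge0.
  rewrite lee_fin indicE yk mulr1 ler_wpM2l// ler_expR mulNr lerN2.
  rewrite ler_pdivlMr ?mulr_gt0// (_ : _ * (4 * t) = k%:R ^+ 2 * t); last by field.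
  case: k yk kmin => [|k] yk kmin; first by rewrite expr0n mul0r sqdist_ge0.
  have : y \notin C k.
    by apply/negP => /kmin; rewrite ltnn.
  rewrite notin_setE => /existsNP[i].
  rewrite -ler_distl => /negP; rewrite -ltNge => h.
  apply: (@le_trans _ _ ((tnth x i - tnth y i) ^+ 2)); last first.
    by rewrite /sqdist (bigD1 i)//= lerDl sumr_ge0// => j _; exact: sqr_ge0.
  rewrite -[X in _ * X <= _](sqr_sqrtr (ltW t0)) -exprMn.
  rewrite -[leRHS]real_normK ?num_real// lerXn2r ?nnegrE ?mulr_ge0 ?sqrtr_ge0//.
  by rewrite distrC ltW.
rewrite integral_nneseries//.
have E k : (\int[mu]_y (c k * \1_(C k) y)%:E)%E = (c k * (2 * (k.+1%:R * Num.sqrt t)) ^+ N)%:E.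
  rewrite real_integralZ//; rewrite integral_indic// setIT /C lebesgue_cube ?mulr_ge0 ?sqrtr_ge0//.
apply: (@le_trans _ _ (A / (1 - z))%:E); last by rewrite lee_fin le_max lexx orbT.
apply: lime_le; first by apply: is_cvg_nneseries => k _ _; exact: integral_ge0.
apply: nearW => n.
apply: (@le_trans _ _ (series (geometric A z) n)%:E); last first.
  by rewrite lee_fin geometric_le_lim// gtr0_norm.
rewrite /series/= -sumEFin; apply: lee_sum => k _.
rewrite E lee_fin /c.
(* The volume (2 sqrt t)^N = (4 t)^(N/2) is compensated by the prefactor (4 pi t)^(-N/2). *)
have Pt : P * (2 * Num.sqrt t) ^+ N <= 1.
  have t4 : 2 * Num.sqrt t = (4 * t) `^ 2^-1.
    by rewrite powR12_sqrt ?mulr_ge0 ?(ltW t0)// sqrtrM// -[4]/((2 * 2)%:R) natrM -expr2 sqrtr_sqr ger0_norm.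
  rewrite t4 -powR_mulrn ?powR_ge0// -powRrM mulrC [2^-1 * _]mulrC /P powRN.
  rewrite ler_pdivrMr ?powR_gt0 ?mulr_gt0 ?pi_gt0// mul1r.
  apply: ge0_ler_powR; rewrite ?nnegrE ?mulr_ge0 ?(ltW t0) ?pi_ge0//.
  have := pi_ge2 R; nra.
rewrite (_ : 2 * _ = 2 * Num.sqrt t * k.+1%:R); last by ring.
rewrite exprMn (_ : _ * _ * _ = P * (2 * Num.sqrt t) ^+ N *
  (k.+1%:R ^+ N * expR (- (k%:R ^+ 2 / 4)))); last by ring.
have h0 : 0 <= k.+1%:R ^+ N * expR (- (k%:R ^+ 2 / 4)) :> R.
  by rewrite mulr_ge0 ?expR_ge0// exprn_ge0.
apply: le_trans (ler_wpM2r h0 Pt) _; rewrite mul1r.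
apply: le_trans (ler_wpM2r (expR_ge0 _) (pow_le_expR N0 (ler0n _ _))) _.
rewrite /A /z -expRM_natr -!mulrA -!expRD ler_wpM2l ?exprn_ge0// ler_expR.
rewrite -natr1; move: (k%:R : R) => K.
have := sqr_ge0 (K / 2 - 2 : R); rewrite expr2; lra.
Qed.

End lebesgue.
End gauss_kernel.

(** * Heat semigroup estimates *)

Section heat.
Context {R : realType} {N : nat} (mu : {measure set (N.-tuple R) -> \bar R}).
Hypothesis mu_sf : sigma_finite setT mu.
Variable M : R.
Hypothesis M1 : 1 <= M.
Hypothesis mass : forall t x, 0 < t -> (\int[mu]_y (gauss_kernel t x y)%:E <= M%:E)%E.

Let M0 : 0 < M. Proof. exact: lt_le_trans M1. Qed.

Lemma measurable_gauss_kernel_r t x : 0 < t ->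
  measurable_fun setT (fun y : N.-tuple R => gauss_kernel t x y).
Proof. by move=> t0; apply: measurable_gauss_kernel => // _; exact: ltW. Qed.

Lemma measurable_heat t g : 0 < t -> measurable_fun setT g ->
  measurable_fun setT (heat mu t g).
Proof.
move=> t0 mg.
rewrite (_ : heat mu t g = fun x => Rintegral mu setT (fun y => gauss_kernel t x y * g y)).
  apply: (measurable_fun_Rintegral mu_sf (F := fun z => gauss_kernel t z.1 z.2 * g z.2)).
  apply: measurable_funM; last exact: measurableT_comp.
  by apply: measurable_gauss_kernel => // _; exact: ltW.
by apply/funext => x; rewrite heatE// gt_eqF.
Qed.

Variable phi : R -> R.
Hypotheses (yphi : young phi) (mphi : measurable_fun setT phi).

Lemma heat_jensen t g x : 0 < t -> measurable_fun setT g ->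
  ((M * phi (`|heat mu t g x| / M))%:E <=
     \int[mu]_y (gauss_kernel t x y * phi `|g y|)%:E)%E.
Proof.
move=> t0 mg.
have mk := measurable_gauss_kernel_r x t0.
have k0 (y : N.-tuple R) : setT y -> 0 <= gauss_kernel t x y.
  by move=> _; exact: gauss_kernel_ge0.
have := jensen measurableT yphi M0 mphi mk mg k0 (mass x t0).
by rewrite heatE ?gt_eqF.
Qed.

(** The pointwise Jensen bound is integrated in x and the order exchanged; by symmetry the kernel
    has mass at most M in x as well, and this M cancels the one on the left. *)
Lemma heat_young t g : 0 < t -> measurable_fun setT g ->
  (\int[mu]_x (phi (`|heat mu t g x| / M))%:E <= \int[mu]_y (phi `|g y|)%:E)%E.
Proof.
move=> t0 mg.
have Mi : (0 <= M^-1)%R by rewrite invr_ge0 ltW.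
have mpg : measurable_fun setT (fun y => phi `|g y|).
  by apply: (measurableT_comp mphi); exact: measurableT_comp.
have mph : measurable_fun setT (fun x => phi (`|heat mu t g x| / M)).
  apply: (measurableT_comp mphi); apply: measurable_funM => //.
  by apply: measurableT_comp => //; exact: measurable_heat.
pose F (z : N.-tuple R * N.-tuple R) := (gauss_kernel t z.1 z.2 * phi `|g z.2|)%:E.
have mF : measurable_fun setT F.
  apply/measurable_EFinP; apply: measurable_funM.
    by apply: measurable_gauss_kernel => // _; exact: ltW.
  by apply: (measurableT_comp mpg).
have F0 z : (0 <= F z)%E.
  by rewrite lee_fin mulr_ge0 ?gauss_kernel_ge0//; apply: young_ge0.
suff : (M%:E * \int[mu]_x (phi (`|heat mu t g x| / M))%:E <=
        M%:E * \int[mu]_y (phi `|g y|)%:E)%E by rewrite lee_pmul2l.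
rewrite -!real_integralZ ?(ltW M0)//; last 2 first.
- by move=> x _; apply: young_ge0.
- by move=> x _; apply: young_ge0 => //; rewrite divr_ge0// ltW.
apply: (@le_trans _ _ (\int[mu]_x \int[mu]_y F (x, y))%E).
  apply: ge0_le_integral => //.
  - by move=> x _; rewrite lee_fin mulr_ge0 ?(ltW M0)// (young_ge0 yphi)// divr_ge0// ltW.
  - by apply/measurable_EFinP; exact: measurable_funM.
  - exact: measurable_fun_integral.
  - by move=> x _; exact: heat_jensen.
rewrite (tonelli_sf mu_sf mu_sf mF F0).
apply: ge0_le_integral => //.
- by move=> x _; apply: integral_ge0.
- apply: (measurable_fun_integral mu_sf (F := fun z => F (z.2, z.1))).
  by apply: measurableT_comp => //; exact: measurable_swap.
- by apply/measurable_EFinP; exact: measurable_funM.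
move=> y _; rewrite /F/=.
under eq_integral do rewrite gauss_kernelC mulrC.
have pg0 : 0 <= phi `|g y| by apply: young_ge0.
rewrite real_integralZ//; last 2 first.
- exact: measurable_gauss_kernel_r.
- by move=> x _; exact: gauss_kernel_ge0.
by rewrite [leRHS]EFinM muleC lee_wpmul2r// mass.
Qed.

End heat.

Section heat_Lr.
Context {R : realType} {N : nat} (mu : {measure set (N.-tuple R) -> \bar R}).
Hypothesis mu_sf : sigma_finite setT mu.
Variable M : R.
Hypothesis M1 : 1 <= M.
Hypothesis mass : forall t x, 0 < t -> (\int[mu]_y (gauss_kernel t x y)%:E <= M%:E)%E.

Let M0 : 0 < M. Proof. exact: lt_le_trans M1. Qed.

Variables (t r A : R) (g : N.-tuple R -> R).
Hypotheses (t0 : 0 < t) (r1 : 1 <= r) (A0 : 0 <= A) (mg : measurable_fun setT g).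
Hypothesis gA : (\int[mu]_y (`|g y| `^ r)%:E <= (A `^ r)%:E)%E.

Let r0 : 0 < r. Proof. exact: lt_le_trans r1. Qed.
Let mphi : measurable_fun setT (fun z : R => z `^ r). Proof. exact: measurable_powR. Qed.

(** Jensen for z^r with the kernel bounded by t^(-N/2). The factor M in front is dropped because M
    >= 1. *)
Lemma heat_Linfty x : `|heat mu t g x| <= M * t `^ (- (N%:R / (2 * r))) * A.
Proof.
have tq0 : 0 <= t `^ (- (N%:R / 2)) by exact: powR_ge0.
have mgr : measurable_fun setT (fun y => `|g y| `^ r).
  by apply: (measurableT_comp mphi); exact: measurableT_comp.
have h1 := heat_jensen M1 mass (young_powR r1) mphi x t0 mg.
have h2 : (\int[mu]_y (gauss_kernel t x y * `|g y| `^ r)%:E <=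
           (t `^ (- (N%:R / 2)) * A `^ r)%:E)%E.
  apply: (@le_trans _ _ (\int[mu]_y (t `^ (- (N%:R / 2)) * `|g y| `^ r)%:E)%E).
    apply: real_integral_le => //.
    - by apply: measurable_funM => //; exact: measurable_gauss_kernel_r.
    - exact: measurable_funM.
    - by move=> y _; rewrite mulr_ge0 ?gauss_kernel_ge0 ?powR_ge0.
    - by move=> y _; rewrite ler_wpM2r ?powR_ge0 ?gauss_kernel_le.
  rewrite real_integralZ//.
  by rewrite EFinM lee_wpmul2l.
have := le_trans h1 h2; rewrite lee_fin => h3.
have h4 : (`|heat mu t g x| / M) `^ r <= t `^ (- (N%:R / 2)) * A `^ r.
  by apply: le_trans h3; rewrite ler_peMl// powR_ge0.
have h5 : t `^ (- (N%:R / 2)) * A `^ r = (t `^ (- (N%:R / (2 * r))) * A) `^ r.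
  rewrite powRM ?powR_ge0// -powRrM; congr (t `^ _ * _).
  by field; rewrite gt_eqF.
move: h4; rewrite h5 => h4.
rewrite -mulrA -ler_pdivrMl// mulrC leNgt; apply/negP => h6.
have := gt0_ltr_powR r0; move=> /(_ _ _ _ _ h6).
rewrite !nnegrE mulr_ge0 ?powR_ge0// divr_ge0 ?(ltW M0)// => /(_ isT isT).
by rewrite ltNge h4.
Qed.

Lemma heat_Lr : (\int[mu]_x (`|heat mu t g x| `^ r)%:E <= ((M * A) `^ r)%:E)%E.
Proof.
have h := heat_young mu_sf M1 mass (young_powR r1) mphi t0 mg.
have mh : measurable_fun setT (fun x => (`|heat mu t g x| / M) `^ r).
  apply: (measurableT_comp mphi); apply: measurable_funM => //.
  by apply: measurableT_comp => //; exact: measurable_heat.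
under eq_integral => x _.
  rewrite (_ : `|heat mu t g x| `^ r = M `^ r * (`|heat mu t g x| / M) `^ r); last first.
    rewrite -powRM ?(ltW M0)// ?divr_ge0 ?(ltW M0)//; congr (_ `^ _).
    by field; rewrite gt_eqF.
  over.
rewrite real_integralZ ?powR_ge0//; last by move=> x _; exact: powR_ge0.
rewrite (powRM r (ltW M0) A0) EFinM.
by apply: lee_wpmul2l; [rewrite lee_fin powR_ge0|exact: le_trans h gA].
Qed.

(** Interpolation: h^2 <= S^(2-r) |h|^r, where S is the sup bound of [heat_Linfty] and the L^r norm
    is controlled by [heat_Lr]. *)
Lemma heat_L2 : r <= 2 ->
  (\int[mu]_x (heat mu t g x ^+ 2)%:E <=
    ((M * t `^ (- (N%:R / 2 * (r^-1 - 2^-1))) * A) ^+ 2)%:E)%E.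
Proof.
move=> r2.
pose S := M * t `^ (- (N%:R / (2 * r))) * A.
have S0 : 0 <= S by rewrite !mulr_ge0 ?powR_ge0// ltW.
have mh : measurable_fun setT (fun x => `|heat mu t g x|).
  by apply: measurableT_comp => //; exact: measurable_heat.
have mhr : measurable_fun setT (fun x => `|heat mu t g x| `^ r).
  exact: (measurableT_comp mphi).
apply: (@le_trans _ _ (\int[mu]_x (S `^ (2 - r) * `|heat mu t g x| `^ r)%:E)%E).
  apply: real_integral_le => //.
  - by apply: measurable_funX; exact: measurable_heat.
  - exact: measurable_funM.
  - by move=> x _; exact: sqr_ge0.
  move=> x _; rewrite -real_normK ?num_real// -powR_mulrn//.
  rewrite -[in leLHS](subrK r 2%:R) powRD; last first.
    by rewrite subrK; apply/implyP => /eqP; lra.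
  by rewrite ler_wpM2r ?powR_ge0// ge0_ler_powR ?nnegrE ?subr_ge0 ?heat_Linfty.
rewrite real_integralZ ?powR_ge0//.
apply: (@le_trans _ _ ((S `^ (2 - r))%:E * ((M * A) `^ r)%:E)%E).
  by rewrite lee_wpmul2l ?lee_fin ?powR_ge0// heat_Lr.
rewrite -EFinM lee_fin /S mulrAC.
have MA0 : 0 <= M * A by rewrite mulr_ge0// ltW.
rewrite (powRM _ MA0 (powR_ge0 _ _)) mulrAC -powRD; last first.
  by rewrite subrK; apply/implyP => /eqP; lra.
rewrite subrK powR_mulrn// -powRrM [in leRHS]mulrAC [in leRHS]exprMn.
rewrite -[X in _ <= _ * X]powR_mulrn ?powR_ge0// -powRrM.
rewrite le_eqVlt; apply/orP; left; apply/eqP; congr (_ * _ `^ _).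
by field; rewrite gt_eqF.
Qed.

End heat_Lr.

(** * Nonlinear estimates in the small class *)

Section pointwise.
Context {R : realType}.
Implicit Types (x y w a b q : R).

Lemma ler_powR_neg w x a : 0 < x -> x <= w -> a <= 0 -> w `^ a <= x `^ a.
Proof. by move=> x0 xw a0; rewrite -[a]opprK powR_neg_le// oppr_ge0. Qed.

(** The first term alone dominates when x <= w, the second when x > w. Integrated, this replaces
    interpolation between L^2 and L^P. *)
Lemma powR_interpolate x w q P : 0 <= x -> 0 < w -> 2 <= q -> q <= P ->
  x `^ q <= w `^ (q - 2) * x `^ 2 + w `^ (q - P) * x `^ P.
Proof.
move=> x0 w0 q2 qP.
have [xw|wx] := leP x w.
  rewrite -[leLHS]addr0 lerD ?mulr_ge0 ?powR_ge0//.
  have -> : x `^ q = x `^ (q - 2) * x `^ 2.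
    by rewrite -powRD ?subrK//; apply/implyP => /eqP; lra.
  by rewrite ler_wpM2r ?powR_ge0// ge0_ler_powR ?nnegrE ?subr_ge0// ltW.
have xgt0 := lt_trans w0 wx.
rewrite -[leLHS]add0r lerD ?mulr_ge0 ?powR_ge0//.
have -> : x `^ q = x `^ (q - P) * x `^ P.
  by rewrite -powRD ?subrK// (gt_eqF xgt0) implybT.
by rewrite ler_wpM2r ?powR_ge0// ler_powR_neg ?(ltW wx)// subr_le0.
Qed.

Lemma young_expm1 : young (fun z : R => expR z - 1).
Proof.
split; first by rewrite expR0 subrr.
move=> z0 z00; exists (expR z0) => [|z zge0]; first exact: expR_ge0.
rewrite -{2}(subrK z0 z) expRD.
have := ler_wpM2r (expR_ge0 z0) (expR_ge1Dx (z - z0)); lra.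
Qed.

(** For X = x^q and Y = exp(k x^2) >= 1: X (Y - 1) <= (X^2 / W + W (Y - 1)^2) / 2 and (Y - 1)^2 <=
    Y^2 - 1. The weight W = w^(q-1) is chosen so that, in the class, both terms integrate to
    multiples of eps^2 w^(q-1). *)
Lemma powR_mulr_expm1_le x w q k : 0 <= x -> 0 < w -> 0 <= k ->
  x `^ q * (expR (k * x ^+ 2) - 1) <=
  2^-1 * (w `^ (- (q - 1)) * x `^ (2 * q) + w `^ (q - 1) * (expR (2 * k * x ^+ 2) - 1)).
Proof.
move=> x0 w0 k0.
have xq : x `^ (2 * q) = (x `^ q) ^+ 2.
  by rewrite -powR_mulrn ?powR_ge0// -powRrM mulrC.
have ek : expR (2 * k * x ^+ 2) = expR (k * x ^+ 2) ^+ 2.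
  by rewrite -expRM_natr; congr expR; ring.
have e1 : 1 <= expR (k * x ^+ 2).
  by apply: le_trans (expR_ge1Dx _); rewrite lerDl mulr_ge0// sqr_ge0.
rewrite xq ek powRN.
have W0 : 0 < w `^ (q - 1) by rewrite powR_gt0.
move: (x `^ q) (expR _) (w `^ _) W0 e1 => X Y W W0 e1.
have h : 0 <= W^-1 * (X - W * (Y - 1)) ^+ 2 by rewrite mulr_ge0 ?invr_ge0 ?(ltW W0)// sqr_ge0.
have e : W^-1 * (X - W * (Y - 1)) ^+ 2 = W^-1 * X ^+ 2 - 2 * X * (Y - 1) + W * (Y - 1) ^+ 2.
  by field; rewrite gt_eqF.
rewrite e in h.
have : W * (Y - 1) ^+ 2 <= W * (Y ^+ 2 - 1) by rewrite ler_pM2l//; nra.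
lra.
Qed.

Lemma ler_powR_expR x a : 0 <= x -> 0 <= a -> x `^ a <= expR (a * x ^+ 2).
Proof.
move=> x0 a0; rewrite mulrC expRM ge0_ler_powR ?nnegrE ?expR_ge0//.
by apply: le_trans (expR_ge1Dx _); have := sqr_ge0 (x - 2^-1); nra.
Qed.

End pointwise.

Section orlicz.
Context {R : realType} {N : nat} (mu : {measure set (N.-tuple R) -> \bar R}).
Variables (eps : R) (u : N.-tuple R -> R).
Hypotheses (eps0 : 0 < eps) (mu_ : measurable_fun setT u)
  (u1 : (orlicz_modular mu u eps <= 1)%E).

Let mnu : measurable_fun setT (fun x => `|u x|). Proof. exact: measurableT_comp. Qed.
Let mpow q : measurable_fun setT (fun x => `|u x| `^ q).
Proof. by apply: (measurableT_comp (measurable_powR _)). Qed.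
Let mexp q : measurable_fun setT (fun x => expR (q * u x ^+ 2)).
Proof. by apply: measurableT_comp => //; apply: measurable_funM => //; exact: measurable_funX. Qed.

(** By convexity, scaling the exponent by the factor k eps^2 <= 1 scales exp - 1 by at least as
    much. The exponential thereby counts as a quantity of order eps^2 and not of order 1. *)
Lemma orlicz_expm1 k : 0 <= k -> k * eps ^+ 2 <= 1 ->
  (\int[mu]_x (expR (k * u x ^+ 2) - 1)%:E <= (k * eps ^+ 2)%:E)%E.
Proof.
move=> k0 ke.
have ke0 : 0 <= k * eps ^+ 2 by rewrite mulr_ge0// sqr_ge0.
have me : measurable_fun setT (fun x => expR (u x ^+ 2 / eps ^+ 2) - 1).
  have := mexp (eps ^+ 2)^-1; under eq_fun do rewrite mulrC.
  by move=> h; apply: measurable_funB.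
have y0 x : 0 <= u x ^+ 2 / eps ^+ 2 by rewrite divr_ge0 ?sqr_ge0.
apply: (@le_trans _ _ (\int[mu]_x ((k * eps ^+ 2) * (expR (u x ^+ 2 / eps ^+ 2) - 1))%:E)%E).
  apply: real_integral_le => //.
  - exact: measurable_funB.
  - exact: measurable_funM.
  - by move=> x _; rewrite subr_ge0; apply: le_trans (expR_ge1Dx _); rewrite lerDl mulr_ge0 ?sqr_ge0.
  - move=> x _; have := young_scale young_expm1 (a := k * eps ^+ 2) _ (y0 x).
    rewrite ke0 ke => /(_ isT); rewrite (_ : _ * (_ / _) = k * u x ^+ 2)//.
    by field; rewrite gt_eqF.
rewrite real_integralZ//; last first.
  by move=> x _; rewrite subr_ge0; apply: le_trans (expR_ge1Dx _); rewrite lerDl.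
by rewrite -[leRHS]mule1 lee_wpmul2l//.
Qed.

Lemma orlicz_L2 : (\int[mu]_x (`|u x| `^ 2)%:E <= (eps `^ 2)%:E)%E.
Proof.
rewrite [X in (_ <= X%:E)%E](_ : _ = eps ^+ 2); last by rewrite powR_mulrn// ltW.
have ei0 : 0 <= (eps ^+ 2)^-1 by rewrite invr_ge0 sqr_ge0.
have := @orlicz_expm1 (eps ^+ 2)^-1 ei0.
rewrite mulVf ?gt_eqF ?exprn_gt0// => /(_ (lexx _)) h.
rewrite -[X in (_ <= X)%E]mule1; apply: le_trans (lee_wpmul2l _ h); last first.
  by rewrite lee_fin sqr_ge0.
rewrite -real_integralZ ?sqr_ge0//; last 2 first.
- exact: measurable_funB.
- by move=> x _; rewrite subr_ge0; apply: le_trans (expR_ge1Dx _); rewrite lerDl mulr_ge0 ?sqr_ge0.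
apply: real_integral_le => //.
- by apply: measurable_funM => //; exact: measurable_funB.
- move=> x _; rewrite powR_mulrn// real_normK ?num_real//.
  rewrite -ler_pdivrMl ?exprn_gt0// lerBrDl; exact: expR_ge1Dx.
Qed.

End orlicz.

Section class.
Context {R : realType} {N : nat} (mu : {measure set (N.-tuple R) -> \bar R}).

(* [w] is the size of the sup norm that the two integral bounds emulate: every
   intermediate norm interpolates as if [|u| <= w] and [int u^2 <= eps^2]. *)
Definition small_class (eps P w : R) (u : N.-tuple R -> R) :=
  [/\ measurable_fun setT u, (orlicz_modular mu u eps <= 1)%E &
      (\int[mu]_x (`|u x| `^ P)%:E <= (eps `^ 2 * w `^ (P - 2))%:E)%E].

Variables (eps P w : R) (u : N.-tuple R -> R).
Hypotheses (eps0 : 0 < eps) (w0 : 0 < w) (uP : small_class eps P w u).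

Let mu_ : measurable_fun setT u. Proof. by case: uP. Qed.
Let mnu : measurable_fun setT (fun x => `|u x|). Proof. exact: measurableT_comp. Qed.
Let mpow q : measurable_fun setT (fun x => `|u x| `^ q).
Proof. by apply: (measurableT_comp (measurable_powR _)). Qed.
Let mexp q : measurable_fun setT (fun x => expR (q * u x ^+ 2)).
Proof. by apply: measurableT_comp => //; apply: measurable_funM => //; exact: measurable_funX. Qed.

Lemma class_Lq q : 2 <= q -> q <= P ->
  (\int[mu]_x (`|u x| `^ q)%:E <= (2 * eps `^ 2 * w `^ (q - 2))%:E)%E.
Proof.
move=> q2 qP.
have m1 : measurable_fun setT (fun x => w `^ (q - 2) * `|u x| `^ 2) by exact: measurable_funM.
have m2 : measurable_fun setT (fun x => w `^ (q - P) * `|u x| `^ P) by exact: measurable_funM.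
apply: (@le_trans _ _ (\int[mu]_x (w `^ (q - 2) * `|u x| `^ 2 + w `^ (q - P) * `|u x| `^ P)%:E)%E).
  apply: real_integral_le => //; first exact: measurable_funD.
  by move=> x _; exact: powR_interpolate.
rewrite real_integralD//; try by move=> x _; rewrite mulr_ge0 ?powR_ge0.
rewrite !real_integralZ ?powR_ge0//.
have [_ u1 _] := uP.
have h1 := lee_wpmul2l (powR_ge0 w (q - 2) : (0 <= (w `^ (q - 2))%:E)%E) (orlicz_L2 eps0 mu_ u1).
have [_ _ h] := uP.
have h2 := lee_wpmul2l (powR_ge0 w (q - P) : (0 <= (w `^ (q - P))%:E)%E) h.
apply: le_trans (leeD h1 h2) _.
rewrite -!EFinM -EFinD lee_fin mulrCA -powRD; last by rewrite (gt_eqF w0) implybT.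
rewrite (_ : q - P + (P - 2) = q - 2); last by ring.
by rewrite [_ * eps `^ 2]mulrC -mulrA; lra.
Qed.

Hypothesis w1 : w <= 1.

(** With exp = 1 + (exp - 1), the first part costs 2 by [class_Lq], and the Young splitting of the
    second costs 1 + k, with w^(q-1) <= w^(q-2) as w <= 1. The power 2q of that splitting forces 2q
    <= P. *)
Lemma class_exp q k : 2 <= q -> 2 * q <= P -> 0 <= k -> 2 * k * eps ^+ 2 <= 1 ->
  (\int[mu]_x (`|u x| `^ q * expR (k * u x ^+ 2))%:E <=
     ((3 + k) * eps `^ 2 * w `^ (q - 2))%:E)%E.
Proof.
move=> q2 qP k0 ke.
have P1 : measurable_fun setT (fun x => w `^ (- (q - 1)) * `|u x| `^ (2 * q)).
  exact: measurable_funM.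
have P2 : measurable_fun setT (fun x => w `^ (q - 1) * (expR (2 * k * u x ^+ 2) - 1)).
  by apply: measurable_funM => //; exact: measurable_funB.
have E0 x : 0 <= expR (2 * k * u x ^+ 2) - 1.
  by rewrite subr_ge0; apply: le_trans (expR_ge1Dx _); rewrite lerDl; apply: mulr_ge0; [apply: mulr_ge0|exact: sqr_ge0].
apply: (@le_trans _ _ (\int[mu]_x (`|u x| `^ q + 2^-1 * (w `^ (- (q - 1)) * `|u x| `^ (2 * q) +
    w `^ (q - 1) * (expR (2 * k * u x ^+ 2) - 1)))%:E)%E).
  apply: real_integral_le => //.
  - exact: measurable_funM.
  - apply: measurable_funD => //; apply: measurable_funM => //; exact: measurable_funD.
  - move=> x _; have := powR_mulr_expm1_le q (normr_ge0 (u x)) w0 k0.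
    rewrite real_normK ?num_real// mulrBr mulr1; lra.
rewrite real_integralD//; last 2 first.
- by apply: measurable_funM => //; exact: measurable_funD.
- by move=> x _; rewrite mulr_ge0// addr_ge0// mulr_ge0 ?powR_ge0.
rewrite real_integralZ//; last 2 first.
- exact: measurable_funD.
- by move=> x _; rewrite addr_ge0// mulr_ge0 ?powR_ge0.
rewrite real_integralD//; last 2 first.
- by move=> x _; rewrite mulr_ge0 ?powR_ge0.
- by move=> x _; rewrite mulr_ge0 ?powR_ge0.
rewrite !real_integralZ ?powR_ge0//; last exact: measurable_funB.
have h1 := class_Lq q2 (_ : q <= P).
have h2 := @class_Lq (2 * q) _ qP.
have [_ u1 _] := uP.
have h3 := @orlicz_expm1 _ _ _ _ _ eps0 mu_ u1 (2 * k) _ ke.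
apply: (@le_trans _ _ ((2 * eps `^ 2 * w `^ (q - 2))%:E + (2^-1)%:E *
  ((w `^ (- (q - 1)))%:E * (2 * eps `^ 2 * w `^ (2 * q - 2))%:E +
   (w `^ (q - 1))%:E * (2 * k * eps ^+ 2)%:E))%E).
  apply: leeD; first by apply: h1; lra.
  apply: lee_wpmul2l; first by rewrite lee_fin.
  apply: leeD; apply: lee_wpmul2l; rewrite ?lee_fin ?powR_ge0//.
    by apply: h2; lra.
  by apply: h3; rewrite mulr_ge0.
rewrite [leLHS](_ : _ = (2 * eps `^ 2 * w `^ (q - 2) + 2^-1 *
  (w `^ (- (q - 1)) * (2 * eps `^ 2 * w `^ (2 * q - 2)) +
   w `^ (q - 1) * (2 * k * eps ^+ 2)))%:E)// lee_fin.
have -> : w `^ (- (q - 1)) * (2 * eps `^ 2 * w `^ (2 * q - 2)) = 2 * eps `^ 2 * w `^ (q - 1).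
  rewrite mulrCA -powRD; last by rewrite (gt_eqF w0) implybT.
  by congr (_ * _ `^ _); ring.
rewrite -(powR_mulrn 2 (ltW eps0)).
have : w `^ (q - 1) <= w `^ (q - 2).
  by apply: ger_powR; rewrite ?w0//; lra.
have := powR_ge0 w (q - 1); have := powR_ge0 eps 2.
move: (w `^ (q - 1)) (w `^ (q - 2)) (eps `^ 2) => W1 W2 E E1 W10 W12.
have : 0 <= E * (W2 - W1) by rewrite mulr_ge0// subr_ge0.
have : 0 <= k * (E * (W2 - W1)) by rewrite !mulr_ge0// subr_ge0.
nra.
Qed.

Variables (f : R -> R) (F k m : R).
Hypotheses (F0 : 0 <= F) (k0 : 0 <= k) (mf : measurable_fun setT f)
  (f_le : forall x, `|f x| <= F * `|x| `^ m * expR (k * x ^+ 2)).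

Lemma class_nonlinearity rho : 1 <= rho -> 2 <= m * rho -> 2 * (m * rho) <= P ->
  2 * (k * rho) * eps ^+ 2 <= 1 ->
  (\int[mu]_x (`|f (u x)| `^ rho)%:E <=
     ((F * (3 + k * rho) * (eps `^ (2 / rho) * w `^ (m - 2 / rho))) `^ rho)%:E)%E.
Proof.
move=> rho1 mr2 mrP kr.
have rho0 : 0 < rho by exact: lt_le_trans rho1.
have krho0 : 0 <= k * rho by rewrite mulr_ge0// ltW.
have := class_exp mr2 mrP krho0 kr => h.
have mm : measurable_fun setT (fun x => `|u x| `^ (m * rho) * expR (k * rho * u x ^+ 2)).
  exact: measurable_funM.
apply: (@le_trans _ _ (\int[mu]_x (F `^ rho * (`|u x| `^ (m * rho) * expR (k * rho * u x ^+ 2)))%:E)%E).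
  apply: real_integral_le => //.
  - apply: (measurableT_comp (measurable_powR _)); apply: measurableT_comp => //.
    exact: measurableT_comp.
  - exact: measurable_funM.
  - move=> x _.
    have -> : F `^ rho * (`|u x| `^ (m * rho) * expR (k * rho * u x ^+ 2)) =
       (F * `|u x| `^ m * expR (k * u x ^+ 2)) `^ rho.
      rewrite !powRM ?mulr_ge0 ?powR_ge0 ?expR_ge0// -powRrM -expRM -mulrA.
      by rewrite mulrA; congr (_ * expR _); ring.
    by rewrite ge0_ler_powR ?nnegrE ?(ltW rho0)// !mulr_ge0 ?powR_ge0 ?expR_ge0.
rewrite real_integralZ ?powR_ge0//.
apply: le_trans (lee_wpmul2l _ h) _; first by rewrite lee_fin powR_ge0.
(* A constant at least 1 is below its own power rho, so it may be moved inside. *)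
have k3 : 1 <= 3 + k * rho by lra.
rewrite -EFinM lee_fin -[F * _ * _]mulrA (powRM _ F0); last by rewrite !mulr_ge0 ?powR_ge0//; lra.
rewrite ler_wpM2l ?powR_ge0// powRM ?mulr_ge0 ?powR_ge0//; last by lra.
rewrite powRM ?powR_ge0// -!powRrM divfK ?gt_eqF// mulrBl divfK ?gt_eqF//.
by rewrite -mulrA ler_wpM2r ?mulr_ge0 ?powR_ge0// le1r_powR.
Qed.

End class.

(** * Weakly singular time integrals *)

Section time_integrals.
Context {R : realType}.
Local Notation leb := (@lebesgue_measure R).

(** The integrands are singular at an endpoint: the fundamental theorem is applied on compact
    subintervals, which exhaust the open interval monotonically. *)
Lemma integral_antiderivative_le (f F : R -> R) (t C : R) : 0 < t ->
  (forall s, 0 < s < t -> {for s, continuous f}) ->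
  (forall s, 0 < s < t -> is_derive s 1 F (f s)) ->
  (forall s, 0 < s < t -> 0 <= f s) ->
  (forall a b, 0 < a -> a < b -> b < t -> F b - F a <= C) ->
  (\int[leb]_(s in `]0%R, t[) (f s)%:E <= C%:E)%E.
Proof.
move=> t0 cf dF f0 FC.
(* The shift by 3 makes 2 h n < t already for n = 0. *)
pose h (n : nat) : R := t / n.+3%:R.
have h0 n : 0 < h n by rewrite divr_gt0.
have hlt n : h n < t - h n.
  rewrite ltrBrDr -mulr2n -mulr_natl /h mulrA ltr_pdivrMr// mulrC ltr_pM2l//.
  by rewrite ltr_nat.
pose G (n : nat) : set R := `[h n, t - h n]%classic.
have GP n s : G n s -> 0 < s < t.
  rewrite /G/= in_itv/= => /andP[hs sh]; apply/andP; split.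
    exact: lt_le_trans (h0 n) hs.
  by apply: le_lt_trans sh _; rewrite ltrBlDr ltrDl.
have EG : \bigcup_i G i = `]0, t[%classic.
  apply/seteqP; split => s /=.
    by case=> n _ /GP; rewrite in_itv.
  rewrite in_itv/= => /andP[s0 st].
  pose k := Num.truncn (t / s + t / (t - s)).
  have ts0 : 0 < t - s by rewrite subr_gt0.
  have hk : t / s + t / (t - s) < k.+3%:R.
    by apply: lt_trans (truncnS_gt _) _; rewrite ltr_nat !ltnS ltnW.
  exists k => //; rewrite /G/= in_itv/=; apply/andP; split.
    rewrite /h ler_pdivrMr// mulrC -ler_pdivrMr//; apply: le_trans (ltW hk).
    by rewrite lerDl divr_ge0// ltW.
  rewrite lerBrDr -lerBrDl /h ler_pdivrMr// mulrC -ler_pdivrMr//; apply: le_trans (ltW hk).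
  by rewrite lerDr divr_ge0// ltW.
have cW n : {within G n, continuous f}.
  by apply: continuous_in_subspaceT => s; rewrite inE => /GP; exact: cf.
have mf n : measurable_fun (G n) (EFin \o f).
  by apply/measurable_EFinP; apply: subspace_continuous_measurable_fun => //; exact: measurable_itv.
have nd : {homo G : n m / (n <= m)%N >-> (n <= m)%O}.
  move=> n m nm; rewrite subsetEset => s; rewrite /G/= !in_itv/= => /andP[a b].
  have : h m <= h n by rewrite /h ler_pM2l// lef_pV2 ?posrE// ler_nat.
  move=> mn; apply/andP; split; first exact: le_trans a.
  by apply: le_trans b _; rewrite lerD2l lerN2.
have := @ge0_nondecreasing_set_cvg_integral _ (measurableTypeR R) R G (EFin \o f) leb nd.
move=> /(_ (fun i => measurable_itv _) mf) cG.
have cv : (\int[leb]_(x in G i) (EFin \o f) x)%E @[i --> \oo] -->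
    (\int[leb]_(x in `]0%R, t[) (f x)%:E)%E.
  by rewrite -EG; apply: cG => i s /GP; rewrite lee_fin; exact: f0.
rewrite -(cvg_lim _ cv)//; apply: lime_le; first by apply/cvg_ex; eexists; exact: cv.
apply: nearW => n.
rewrite (@continuous_FTC2 _ f F)//.
- rewrite -EFinB lee_fin; apply: FC; [exact: h0|exact: hlt|by rewrite ltrBlDr ltrDl].
- exact: cW.
- have dc s : 0 < s < t -> {for s, continuous F}.
    move=> /dF d; apply: differentiable_continuous; apply/derivable1_diffP.
    exact: ex_derive.
  split.
  + move=> s; rewrite in_itv/= => /andP[a b]; have : G n s.
      by rewrite /G/= in_itv/= (ltW a) (ltW b).
    by move=> /GP /dF d; exact: ex_derive.
  + by apply: cvg_at_right_filter; apply: dc; apply: (GP n); rewrite /G/= in_itv/= lexx ltW.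
  + by apply: cvg_at_left_filter; apply: dc; apply: (GP n); rewrite /G/= in_itv/= lexx ltW.
- move=> s; rewrite in_itv/= => /andP[a b]; have : G n s.
    by rewrite /G/= in_itv/= (ltW a) (ltW b).
  by move=> /GP /dF d; rewrite derive1E; exact: derive_val.
Qed.

Lemma is_derive_powR (a s : R) : 0 < s -> is_derive s 1 (fun x : R => x `^ a) (a * s `^ (a - 1)).
Proof.
move=> s0; have si : s \in `]0, +oo[ by rewrite in_itv/= s0.
apply: DeriveDef; first exact: derivable_powR.
by rewrite -derive1E powR_derive1.
Qed.

Lemma continuous_powR_pos (a s : R) : 0 < s -> {for s, continuous (fun x : R => x `^ a)}.
Proof.
move=> s0; apply: differentiable_continuous; apply/derivable1_diffP.
by apply: derivable_powR; rewrite in_itv/= s0.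
Qed.

Lemma integral_powR_le (a t : R) : 0 < t -> a < 1 ->
  (\int[leb]_(s in `]0%R, t[) (s `^ (- a))%:E <= (t `^ (1 - a) / (1 - a))%:E)%E.
Proof.
move=> t0 a1; have a10 : 0 < 1 - a by rewrite subr_gt0.
apply: (integral_antiderivative_le (F := fun s => (1 - a)^-1 * s `^ (1 - a))).
- exact: t0.
- by move=> s /andP[s0 _]; exact: continuous_powR_pos.
- move=> s /andP[s0 _]; have := is_derive_powR (1 - a) s0 => dp.
  apply: is_derive_eq; rewrite /GRing.scale/= mulrA mulVf ?gt_eqF// mul1r.
  by rewrite addrAC subrr add0r.
- by move=> s _; exact: powR_ge0.
- move=> b c b0 bc ct; rewrite [leRHS]mulrC -mulrBr ler_wpM2l ?invr_ge0 ?(ltW a10)//.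
  rewrite lerBlDr -[leLHS]addr0 lerD ?powR_ge0//.
  by rewrite ge0_ler_powR ?nnegrE ?(ltW a10) ?(ltW ct) ?(ltW t0)// ltW// (lt_trans b0).
Qed.

Lemma integral_powR_rev_le (a t : R) : 0 < t -> a < 1 ->
  (\int[leb]_(s in `]0%R, t[) ((t - s) `^ (- a))%:E <= (t `^ (1 - a) / (1 - a))%:E)%E.
Proof.
move=> t0 a1; have a10 : 0 < 1 - a by rewrite subr_gt0.
apply: (integral_antiderivative_le (F := fun s => - ((1 - a)^-1 * (t - s) `^ (1 - a)))).
- exact: t0.
- move=> s /andP[s0 st]; have ts : 0 < t - s by rewrite subr_gt0.
  apply: (@continuous_comp _ _ _ (fun x : R => t - x) (fun x : R => x `^ (- a))).
    by apply: cvgB; [exact: cvg_cst|exact: cvg_id].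
  exact: continuous_powR_pos.
- move=> s /andP[s0 st]; have ts : 0 < t - s by rewrite subr_gt0.
  have dp := is_derive_powR (1 - a) ts.
  have dts : is_derive s 1 (fun x : R => t - x) (- 1) by rewrite -[-1]add0r; apply: is_deriveB.
  have dc := @is_derive1_comp R (fun x => x `^ (1 - a)) (fun x => t - x) s _ _ dp dts.
  have := is_deriveN (is_deriveZ (1 - a)^-1 dc).
  rewrite /GRing.scale/= mulrN1 mulrN opprK mulrA mulVf ?gt_eqF// mul1r.
  by rewrite addrAC subrr add0r.
- by move=> s _; exact: powR_ge0.
- move=> b c b0 bc ct; rewrite opprK addrC [leRHS]mulrC -mulrBr ler_wpM2l ?invr_ge0 ?(ltW a10)//.
  rewrite lerBlDr -[leLHS]addr0 lerD ?powR_ge0//.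
  by rewrite ge0_ler_powR ?nnegrE ?(ltW a10) ?(ltW t0) ?subr_ge0//; lra.
Qed.

End time_integrals.

(** * Minkowski's inequality in time *)

Section duhamel.
Context {R : realType} d (T : measurableType d) (mu : {measure set T -> \bar R}).
Hypothesis mu_sf : sigma_finite setT mu.
Local Notation leb := (@lebesgue_measure R).
Local Notation S := (measurableTypeR R).
Variables (t : R) (H : R -> T -> R).
Local Notation D := (`]0, t[%classic : set S).
Hypothesis mH : measurable_fun (D `*` [set: T] : set (S * T)) (fun z : S * T => H z.1 z.2).

Let mD : measurable D. Proof. exact: measurable_itv. Qed.

(** Extension by zero, so that Tonelli can be used on the whole product. *)
Let Hr (z : S * T) : R := ((fun z : S * T => H z.1 z.2) \_ (D `*` [set: T])) z.

Let HrE s x : D s -> Hr (s, x) = H s x.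
Proof. by move=> Ds; rewrite /Hr patchE ifT// inE. Qed.

Let Hr0 s x : ~ D s -> Hr (s, x) = 0.
Proof. by move=> Ds; rewrite /Hr patchE ifF//; apply/negP; rewrite inE => -[]. Qed.

Let mHr : measurable_fun [set: S * T] Hr.
Proof. by apply/(measurable_restrictT _ _).1 => //; exact: measurableX. Qed.

Lemma duhamel_section x : measurable_fun D (fun s => H s x).
Proof.
apply: (@eq_measurable_fun _ _ _ _ _ (fun s => Hr (s, x))).
  by move=> s; rewrite inE => Ds; rewrite HrE.
by apply: measurable_funTS; apply: measurableT_comp.
Qed.

(** The mild formula integrates over the closed interval, where at s = t [heat] is the identity by
    definition; measurability is known only inside, and the endpoints are null. *)
Lemma duhamel_closed x :
  Rintegral leb `[0, t] (fun s => H s x) = Rintegral leb `]0, t[ (fun s => H s x).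
Proof.
have m := duhamel_section x.
have mE : measurable_fun D (fun s => (H s x)%:E) by exact/measurable_EFinP.
rewrite /Rintegral [in RHS]integral_itv_obnd_cbnd//.
have mE' : measurable_fun `[0, t[ (fun s : S => (H s x)%:E).
  by apply/measurable_EFinP; exact: measurable_fun_itv_co m.
by rewrite -integral_itv_bndo_bndc.
Qed.

Lemma measurable_duhamel :
  measurable_fun setT (fun x => Rintegral leb D (fun s => H s x)).
Proof.
rewrite (_ : (fun x => _) = fun x => Rintegral leb setT (fun s => Hr (s, x))).
  have sl : sigma_finite setT leb by exact: sigma_finiteT.
  apply: (measurable_fun_Rintegral sl (F := fun z => Hr (z.2, z.1))).
  by apply: measurableT_comp => //; exact: measurable_swap.
apply/funext => x; rewrite Rintegral_mkcond; congr Rintegral; apply/funext => s.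
rewrite patchE; case: ifPn => [|]; first by rewrite inE => Ds; rewrite HrE.
by rewrite notin_setE => Ds; rewrite Hr0.
Qed.

Variables (b : R -> R) (B : R).
Hypotheses (mb : measurable_fun [set: S] b) (b0 : forall s, 0 < s < t -> 0 < b s).
Hypothesis bB : (\int[leb]_(s in D) (b s)%:E <= B%:E)%E.

Let Db s : D s -> 0 < b s.
Proof. by move=> Ds; apply: b0; move: Ds; rewrite /= in_itv. Qed.

Lemma duhamel_Linfty x : (forall s, 0 < s < t -> `|H s x| <= b s) ->
  `|Rintegral leb D (fun s => H s x)| <= B.
Proof.
move=> Hb; rewrite -lee_fin.
apply: le_trans (le_normr_Rintegral_ge0 leb mD (duhamel_section x)) _.
apply: le_trans bB; apply: real_integral_le => //.
- by apply: measurableT_comp => //; exact: duhamel_section.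
- exact: measurable_funTS.
Qed.

(** Minkowski's inequality by Jensen for the square: writing H = b (H/b) with b of mass at most B
    gives (int H)^2 <= B int H^2/b. Integrated in x, H^2/b costs at most b, whose time integral is
    again at most B. *)
Lemma duhamel_L2 : 0 < B ->
  (forall s, 0 < s < t -> (\int[mu]_x (H s x ^+ 2)%:E <= (b s ^+ 2)%:E)%E) ->
  (\int[mu]_x (Rintegral leb D (fun s => H s x) ^+ 2)%:E <= (B ^+ 2)%:E)%E.
Proof.
move=> B0 Hb.
have sl : sigma_finite setT leb by exact: sigma_finiteT.
pose F (z : S * T) := ((b z.1) `^ (-1) * Hr z ^+ 2)%:E.
have F0 z : (0 <= F z)%E by rewrite lee_fin mulr_ge0 ?powR_ge0 ?sqr_ge0.
have mF : measurable_fun setT F.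
  apply/measurable_EFinP; apply: measurable_funM; last exact: measurable_funX.
  by apply: (measurableT_comp (measurable_powR _)); exact: measurableT_comp.
have mFx x : measurable_fun setT (fun s => F (s, x)) by apply: measurableT_comp.
have mFs s : measurable_fun setT (fun x => F (s, x)) by apply: measurableT_comp.
have pt x : ((Rintegral leb D (fun s => H s x) ^+ 2)%:E <= B%:E * \int[leb]_s F (s, x))%E.
  have mg : measurable_fun D (fun s => b s `^ (-1) * H s x).
    apply: measurable_funM; last exact: duhamel_section.
    by apply: (measurableT_comp (measurable_powR _)); exact: measurable_funTS.
  have ms : measurable_fun setT (fun z : R => z ^+ 2) by exact: exprn_measurable.
  have := jensen mD young_sqr B0 ms (measurable_funTS mb) mg (fun s Ds => ltW (Db Ds)) bB.
  rewrite (_ : Rintegral leb D (fun s => b s * _) = Rintegral leb D (fun s => H s x)); last first.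
    apply: eq_Rintegral => s; rewrite inE => Ds.
    by rewrite powR_inv1 ?(ltW (Db Ds))// mulVKf// gt_eqF// Db.
  have -> : (\int[leb]_(s in D) (b s * `|(b s `^ (-1) * H s x)%R| ^+ 2)%:E =
             \int[leb]_s F (s, x))%E.
    rewrite integral_mkcond; apply: eq_integral => s _; rewrite patchE.
    case: ifPn => [|]; last by rewrite notin_setE => Ds; rewrite /F Hr0// expr0n mulr0.
    rewrite inE => Ds; rewrite /F HrE// real_normK ?num_real// exprMn.
    have bs := Db Ds; rewrite powR_inv1 ?(ltW bs)//; congr EFin.
    by field; rewrite gt_eqF.
  move=> h; apply: le_trans (lee_wpmul2l _ h); last by rewrite lee_fin ltW.
  rewrite -EFinM lee_fin expr_div_n real_normK ?num_real//.
  by rewrite le_eqVlt; apply/orP; left; apply/eqP; field; rewrite gt_eqF.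
apply: (@le_trans _ _ (\int[mu]_x (B%:E * \int[leb]_s F (s, x)))%E).
  apply: ge0_le_integral => //.
  - by move=> x _; rewrite lee_fin sqr_ge0.
  - by apply/measurable_EFinP; apply: measurable_funX; exact: measurable_duhamel.
  - apply: emeasurable_funM => //.
    apply: (measurable_fun_integral sl (F := fun z => F (z.2, z.1))).
    by apply: measurableT_comp => //; exact: measurable_swap.
rewrite ge0_integralZl//; last 3 first.
- apply: (measurable_fun_integral sl (F := fun z => F (z.2, z.1))).
  by apply: measurableT_comp => //; exact: measurable_swap.
- by move=> x _; exact: integral_ge0.
- by rewrite lee_fin ltW.
rewrite -(tonelli_sf sl mu_sf mF F0) expr2 EFinM lee_wpmul2l ?lee_fin ?(ltW B0)//.
apply: le_trans bB; rewrite [leRHS]integral_mkcond.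
apply: ge0_le_integral => //.
- by move=> s _; exact: integral_ge0.
- exact: measurable_fun_integral.
- by apply/(measurable_restrictT _ _).1 => //; apply/measurable_EFinP; exact: measurable_funTS.
move=> s _; rewrite patchE; case: ifPn => [|]; last first.
  rewrite notin_setE => Ds; rewrite integral0_eq// => x _.
  by rewrite /F Hr0// expr0n mulr0.
rewrite inE => Ds; have bs := Db Ds.
have mHs : measurable_fun setT (H s).
  by rewrite (_ : H s = fun x => Hr (s, x)); [exact: measurableT_comp|apply/funext => x; rewrite HrE].
under eq_integral do rewrite /F HrE//=.
rewrite real_integralZ ?powR_ge0//; last 2 first.
- exact: measurable_funX.
- by move=> x _; exact: sqr_ge0.
have Ds' : 0 < s < t by move: Ds; rewrite /= in_itv.
apply: le_trans (lee_wpmul2l _ (Hb s Ds')) _; first by rewrite lee_fin powR_ge0.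
rewrite -EFinM lee_fin powR_inv1 ?(ltW bs)// le_eqVlt; apply/orP; left; apply/eqP.
by field; rewrite gt_eqF.
Qed.

End duhamel.

(** * Joint measurability of the Duhamel integrand *)

Section countable_parameter.
Context {R : realType} d (T : measurableType d).
Local Notation S := (measurableTypeR R).

Lemma measurable_truncn_fiber (c : R) (k : nat) :
  measurable [set s : S | Num.truncn (s * c) = k].
Proof.
have mB (j : nat) : measurable [set s : S | (Num.truncn (s * c) <= j)%N].
  rewrite (_ : [set _ | _] = [set s : S | s * c < j.+1%:R]); last first.
    by apply/seteqP; split => s /=; rewrite truncn_le_nat.
  have mc : measurable_fun [set: S] (fun s : S => s * c) by exact: measurable_funM.
  have := mc measurableT _ (measurable_itv `]-oo, j.+1%:R[).
  by rewrite setTI; congr measurable; apply/seteqP; split => s /=; rewrite in_itv.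
case: k => [|k].
  rewrite (_ : [set _ | _] = [set s : S | (Num.truncn (s * c) <= 0)%N])//.
  by apply/seteqP; split => s /=; rewrite leqn0 => /eqP.
rewrite (_ : [set _ | _] = [set s : S | (Num.truncn (s * c) <= k.+1)%N] `\`
   [set s : S | (Num.truncn (s * c) <= k)%N]); last first.
  apply/seteqP; split => s /=; first by move=> ->; rewrite leqnn ltnn.
  by move=> [a /negP]; rewrite -ltnNge => b; apply/eqP; rewrite eqn_leq a b.
exact: measurableD.
Qed.

(** The time enters through countably many values only, so each preimage is a countable union of
    measurable rectangles. *)
Lemma measurable_fun_truncn_param (c : R) (G : nat -> T -> R) :
  (forall k, measurable_fun setT (G k)) ->
  measurable_fun setT (fun z : S * T => G (Num.truncn (z.1 * c)) z.2).
Proof.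
move=> mG _ A mA; rewrite setTI.
rewrite (_ : _ @^-1` _ = \bigcup_k ([set s : S | Num.truncn (s * c) = k] `*` (G k @^-1` A))).
  apply: bigcupT_measurable => k; apply: measurableX; first exact: measurable_truncn_fiber.
  by rewrite -[X in measurable X]setTI; exact: mG.
apply/seteqP; split => [[s x]/= h|[s x] [k _ [/= <-]]//].
by exists (Num.truncn (s * c)).
Qed.

End countable_parameter.

Section heat_path.
Context {R : realType} {N : nat} (mu : {measure set (N.-tuple R) -> \bar R}).
Hypothesis mu_sf : sigma_finite setT mu.
Local Notation S := (measurableTypeR R).
Local Notation T := (N.-tuple R).

Lemma integrable_gauss_kernel t x (g : T -> R) : 0 < t -> measurable_fun setT g ->
  (\int[mu]_y `|g y|%:E < +oo)%E ->
  mu.-integrable setT (EFin \o (fun y => gauss_kernel t x y * g y)).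
Proof.
move=> t0 mg gi.
have mkg : measurable_fun setT (fun y => gauss_kernel t x y * g y).
  by apply: measurable_funM => //; exact: measurable_gauss_kernel_r.
apply/integrableP; split; first exact/measurable_EFinP.
apply: (@le_lt_trans _ _ (\int[mu]_y (t `^ (- (N%:R / 2)) * `|g y|)%:E)%E).
  apply: real_integral_le => //.
  - exact: measurableT_comp.
  - by apply: measurable_funM => //; exact: measurableT_comp.
  - move=> y _; rewrite normrM (ger0_norm (gauss_kernel_ge0 _ _ _)).
    by rewrite ler_wpM2r// gauss_kernel_le.
rewrite real_integralZ ?powR_ge0//; last exact: measurableT_comp.
by apply: lte_mul_pinfty => //; rewrite lee_fin powR_ge0.
Qed.

Lemma heat_L1_dist t x (g h : T -> R) : 0 < t ->
  measurable_fun setT g -> measurable_fun setT h ->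
  (\int[mu]_y `|g y|%:E < +oo)%E -> (\int[mu]_y `|h y|%:E < +oo)%E ->
  (`|heat mu t g x - heat mu t h x|%:E <=
     (t `^ (- (N%:R / 2)))%:E * \int[mu]_y `|g y - h y|%:E)%E.
Proof.
move=> t0 mg mh gi hi; rewrite !heatE ?gt_eqF// -RintegralB//; last 2 first.
- exact: integrable_gauss_kernel.
- exact: integrable_gauss_kernel.
have mgh : measurable_fun setT (fun y => `|g y - h y|).
  by apply: measurableT_comp => //; exact: measurable_funB.
have mk := measurable_gauss_kernel_r x t0.
have mm : measurable_fun setT (fun y => gauss_kernel t x y * g y - gauss_kernel t x y * h y).
  by apply: measurable_funB; exact: measurable_funM.
apply: le_trans (le_normr_Rintegral_ge0 mu measurableT mm) _.
rewrite -real_integralZ ?powR_ge0//.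
apply: real_integral_le => //.
- exact: measurableT_comp.
- exact: measurable_funM.
- move=> y _; rewrite -mulrBr normrM (ger0_norm (gauss_kernel_ge0 _ _ _)).
  by rewrite ler_wpM2r// gauss_kernel_le.
Qed.

Variables (t : R) (g : R -> T -> R).
Hypothesis mg : forall s : R, 0 <= s < t -> measurable_fun setT (g s).
Hypothesis gi : forall s : R, 0 <= s < t -> (\int[mu]_y `|g s y|%:E < +oo)%E.
Hypothesis cg : forall s : R, 0 < s < t -> forall e : R, 0 < e -> exists2 dl : R, 0 < dl &
  forall s' : R, 0 <= s' < t -> `|s' - s| < dl -> (\int[mu]_y `|g s' y - g s y|%:E <= e%:E)%E.

(* Only the L^1-continuity of [g] in time is available, so [g s] is frozen at the
   grid point below [s] and the mesh is sent to 0. *)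
Lemma measurable_heat_path :
  measurable_fun ((`]0, t[%classic : set S) `*` [set: T] : set (S * T))
    (fun z : S * T => heat mu (t - z.1) (g z.1) z.2).
Proof.
pose D : set S := `]0, t[%classic.
have DP s : D s -> 0 < s < t by rewrite /D/= in_itv.
(* The grid point k/(n+1) is unrestricted, so [g] is set to 0 outside [0, t) to make every slice
   measurable. *)
pose g' s := if 0 <= s < t then g s else cst 0.
have mg' s : measurable_fun setT (g' s).
  by rewrite /g'; case: ifPn => // st; exact: mg.
pose G (n k : nat) : T -> R := g' (k%:R / n.+1%:R).
(* The maximum keeps the kernel time nonnegative for all s; it is t - s on the interval of
   interest. *)
pose K (z : S * T) (y : T) := gauss_kernel (Num.max 0 (t - z.1)) z.2 y.
pose Hn (n : nat) (z : S * T) : R :=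
  Rintegral mu setT (fun y => K z y * G n (Num.truncn (z.1 * n.+1%:R)) y).
have mHn n : measurable_fun setT (Hn n).
  apply: (measurable_fun_Rintegral mu_sf (F := fun w : (S * T) * T =>
    K w.1 w.2 * G n (Num.truncn (w.1.1 * n.+1%:R)) w.2)).
  apply: measurable_funM.
    apply: (@measurable_gauss_kernel R N _ ((S * T) * T)%type
      (fun w => Num.max 0 (t - w.1.1)) (fun w => w.1.2) (fun w => w.2)).
    - by move=> w; rewrite le_max lexx.
    - apply: measurable_maxr => //; apply: measurable_funB => //.
      by apply: measurableT_comp => //.
    - by apply: measurableT_comp => //.
    - exact: measurable_snd.
  have := @measurable_fun_truncn_param R _ T n.+1%:R (G n) (fun k => mg' _) => mG.
  have mp : measurable_fun [set: (S * T) * T] (fun w : (S * T) * T => (w.1.1, w.2) : S * T).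
    have m1 : measurable_fun [set: (S * T) * T] (fun w : (S * T) * T => w.1.1).
      by apply: measurableT_comp => //.
    have m2 : measurable_fun [set: (S * T) * T] (fun w : (S * T) * T => w.2).
      exact: measurable_snd.
    exact: measurable_fun_pair m1 m2.
  exact: (measurableT_comp mG mp).
apply: (@measurable_fun_cvg _ _ _ _ Hn) => [n|[s x] [/= Ds _]]; first exact: measurable_funTS.
have /andP[s0 st] := DP _ Ds.
have ts : 0 < t - s by rewrite subr_gt0.
apply/cvgrPdist_le => e e0.
pose c := (t - s) `^ (- (N%:R / 2)).
have c0 : 0 < c by rewrite powR_gt0.
have [dl dl0 Hdl] := cg (DP _ Ds) (divr_gt0 e0 c0).
near=> n.
have n0 : 0 < n.+1%:R :> R by [].
pose q := (Num.truncn (s * n.+1%:R))%:R / n.+1%:R : R.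
have sn0 : 0 <= s * n.+1%:R by rewrite mulr_ge0// ltW.
have q0 : 0 <= q by rewrite divr_ge0.
have qs : q <= s by rewrite ler_pdivrMr// truncn_le.
have sq : s < q + n.+1%:R^-1.
  by rewrite -[n.+1%:R^-1]mul1r -mulrDl ltr_pdivlMr// natr1 truncnS_gt.
have qt : 0 <= q < t by rewrite q0 (le_lt_trans qs).
have -> : Hn n (s, x) = heat mu (t - s) (g q) x.
  rewrite heatE ?gt_eqF// /Hn /K/= max_r ?(ltW ts)//; apply: eq_Rintegral => y _.
  by rewrite /G -/q /g' qt.
rewrite -lee_fin; apply: le_trans (heat_L1_dist _ _ _ _ _ _) _ => //.
- by apply: mg; rewrite (ltW s0).
- exact: mg.
- by apply: gi; rewrite (ltW s0).
- exact: gi.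
have -> : e%:E = (c%:E * (e / c)%:E)%E by rewrite -EFinM mulrC divfK ?gt_eqF.
rewrite -/c lee_wpmul2l ?lee_fin ?(ltW c0)//.
under eq_integral do rewrite distrC.
apply: Hdl => //; rewrite distrC ger0_norm ?subr_ge0//.
apply: (@lt_trans _ _ n.+1%:R^-1); first by rewrite ltrBlDl.
near: n; exact: near_infty_natSinv_lt (PosNum dl0).
Unshelve. all: by end_near.
Qed.

End heat_path.

(** * The Luxemburg ball *)

Section luxemburg.
Context {R : realType} {N : nat} (mu : {measure set (N.-tuple R) -> \bar R}).
Local Notation T := (N.-tuple R).
Implicit Types (u v : T -> R) (a b : R).

(** Membership in the set whose infimum is the norm. Estimates are made on it, since the infimum
    need not be attained and is 0 by default when the set is empty. *)
Definition luxemburg_ball u a := 0 < a /\ (orlicz_modular mu u a <= 1)%E.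

Lemma orlicz_modularE u a :
  orlicz_modular mu u a = (\int[mu]_x (Phi (`|u x| / a))%:E)%E.
Proof.
by apply: eq_integral => x _; rewrite /Phi expr_div_n real_normK ?num_real.
Qed.

Lemma measurable_Phi : measurable_fun setT (@Phi R).
Proof.
by apply: measurable_funB => //; apply: measurableT_comp.
Qed.

Lemma Phi_ge0 (x : R) : 0 <= Phi x.
Proof. by rewrite subr_ge0; apply: le_trans (expR_ge1Dx _); rewrite lerDl sqr_ge0. Qed.

Lemma measurable_Phi_comp u c : measurable_fun setT u ->
  measurable_fun setT (fun x => Phi (`|u x| * c)).
Proof.
move=> mu_; apply: (measurableT_comp measurable_Phi).
by apply: measurable_funM => //; exact: measurableT_comp.
Qed.

Lemma luxemburg_ball_le u a b : measurable_fun setT u -> luxemburg_ball u a ->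
  a <= b -> luxemburg_ball u b.
Proof.
move=> mu_ [a0 ua] ab; have b0 := lt_le_trans a0 ab; split; first exact: b0.
apply: le_trans ua; rewrite !orlicz_modularE.
apply: real_integral_le => //; try exact: measurable_Phi_comp.
- by move=> x _; exact: Phi_ge0.
- move=> x _; apply: (young_le young_Phi); first by rewrite divr_ge0// ltW.
  by rewrite ler_wpM2l// lef_pV2.
Qed.

(** If the modular at a is r, enlarging a by the factor r + 1 divides it by at least r + 1, by
    convexity. *)
Lemma in_expL2_ball u : in_expL2 mu u -> exists a, luxemburg_ball u a.
Proof.
move=> [[mu_ _] [a [a0 +]]].
have m0 : (0 <= orlicz_modular mu u a)%E.
  by rewrite orlicz_modularE; apply: real_integral_ge0 => x _; exact: Phi_ge0.
case E : (orlicz_modular mu u a) m0 => [r| |]//; rewrite lee_fin => r0 _.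
have k0 : 0 < r + 1 by rewrite ltr_wpDl.
exists (a * (r + 1)); split; first exact: mulr_gt0.
rewrite orlicz_modularE.
have Mi : 0 <= (r + 1)^-1 by rewrite invr_ge0 ltW.
apply: (@le_trans _ _ (\int[mu]_x ((r + 1)^-1 * Phi (`|u x| / a))%:E)%E).
  apply: real_integral_le => //.
  - exact: measurable_Phi_comp.
  - by apply: measurable_funM => //; exact: measurable_Phi_comp.
  - by move=> x _; exact: Phi_ge0.
  - move=> x _; rewrite invfM (_ : _ * (_ * _) = (r + 1)^-1 * (`|u x| / a)); last by ring.
    apply: (@young_scale R (@Phi R) _ _ young_Phi); last by rewrite divr_ge0// ltW.
    by rewrite Mi invf_le1//; lra.
rewrite real_integralZ//; last 2 first.
- exact: measurable_Phi_comp.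
- by move=> x _; exact: Phi_ge0.
rewrite -orlicz_modularE E -EFinM lee_fin ler_pdivrMl//; lra.
Qed.

(** The ball of radius [b] only serves to exclude the empty set, for which a small norm would say
    nothing. *)
Lemma luxemburg_ball_norm u a b : measurable_fun setT u -> luxemburg_ball u b ->
  expL2_norm mu u < a -> luxemburg_ball u a.
Proof.
move=> mu_ ub; rewrite /expL2_norm => /inf_lt[].
  by exists b.
move=> c [c0 uc] ca; exact: luxemburg_ball_le mu_ (conj c0 uc) (ltW ca).
Qed.

Lemma luxemburg_ballD u v a b : measurable_fun setT u -> measurable_fun setT v ->
  luxemburg_ball u a -> luxemburg_ball v b -> luxemburg_ball (fun x => u x + v x) (a + b).
Proof.
move=> mu_ mv [a0 ua] [b0 vb]; have ab0 : 0 < a + b by exact: addr_gt0.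
split; first exact: ab0.
rewrite orlicz_modularE.
pose al := a / (a + b); pose be := b / (a + b).
have al0 : 0 <= al by rewrite divr_ge0// ltW.
have be0 : 0 <= be by rewrite divr_ge0// ltW.
have ab1 : al + be = 1 by rewrite /al /be -mulrDl divff// gt_eqF.
have m1 := measurable_Phi_comp a^-1 mu_.
have m2 := measurable_Phi_comp b^-1 mv.
apply: (@le_trans _ _ (\int[mu]_x (al * Phi (`|u x| / a) + be * Phi (`|v x| / b))%:E)%E).
  apply: real_integral_le => //.
  - by apply: (measurable_Phi_comp _ (u := fun x => u x + v x)); exact: measurable_funD.
  - by apply: measurable_funD; exact: measurable_funM.
  - by move=> x _; exact: Phi_ge0.
  move=> x _; apply: le_trans (young_convex young_Phi al0 be0 ab1 _ _); last 2 first.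
  - by rewrite divr_ge0// ltW.
  - by rewrite divr_ge0// ltW.
  apply: (young_le young_Phi); first by rewrite divr_ge0// ltW.
  have -> : al * (`|u x| / a) + be * (`|v x| / b) = (`|u x| + `|v x|) / (a + b).
    by rewrite /al /be; field; rewrite !gt_eqF.
  by rewrite ler_wpM2r ?invr_ge0 ?(ltW ab0)// ler_normD.
rewrite real_integralD//; last 4 first.
- exact: measurable_funM.
- exact: measurable_funM.
- by move=> x _; rewrite mulr_ge0 ?Phi_ge0.
- by move=> x _; rewrite mulr_ge0 ?Phi_ge0.
rewrite !real_integralZ//; try by move=> x _; exact: Phi_ge0.
rewrite -!orlicz_modularE -ab1 EFinD.
apply: leeD; rewrite -[X in (_ <= X)%E]mule1.
  by apply: (lee_wpmul2l _ ua); rewrite lee_fin.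
by apply: (lee_wpmul2l _ vb); rewrite lee_fin.
Qed.

Lemma luxemburg_ballN u a : luxemburg_ball u a -> luxemburg_ball (fun x => - u x) a.
Proof.
move=> [a0 ua]; split; first exact: a0.
rewrite orlicz_modularE.
by under eq_integral do rewrite normrN; rewrite -orlicz_modularE.
Qed.

Lemma luxemburg_ball_ae u v a : measurable_fun setT u -> measurable_fun setT v ->
  {ae mu, forall x, u x = v x} -> luxemburg_ball u a -> luxemburg_ball v a.
Proof.
move=> mu_ mv uv [a0 ua]; split; first exact: a0.
apply: le_trans ua; rewrite !orlicz_modularE.
rewrite le_eqVlt; apply/orP; left; apply/eqP; apply: ae_eq_integral => //.
- by apply/measurable_EFinP; exact: measurable_Phi_comp.
- by apply/measurable_EFinP; exact: measurable_Phi_comp.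
- by apply: filterS uv => x -> _.
Qed.

(** The constant is that of the substitution x = sqrt q y. Then exp(q y^2) = E E F with E = exp(y^2)
    and F = exp((q-2) y^2), and y^2 y^(q-2) <= (E - 1) F <= E E F - 1. *)
Lemma powR_le_Phi (q x : R) : 2 <= q -> 0 <= x -> x `^ q <= q `^ (q / 2) * Phi x.
Proof.
move=> q2 x0; have q0 : 0 < q by lra.
pose y := x / Num.sqrt q.
have sq0 : 0 < Num.sqrt q by rewrite sqrtr_gt0.
have y0 : 0 <= y by rewrite divr_ge0// ltW.
have xE : x = Num.sqrt q * y by rewrite /y mulrC divfK// gt_eqF.
have -> : x `^ q = q `^ (q / 2) * y `^ q.
  rewrite xE powRM ?sqrtr_ge0//; congr (_ * _).
  by rewrite -powR12_sqrt ?(ltW q0)// -powRrM mulrC.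
rewrite ler_wpM2l ?powR_ge0// /Phi xE exprMn sqr_sqrtr ?(ltW q0)//.
have -> : y `^ q = y ^+ 2 * y `^ (q - 2).
  by rewrite -powR_mulrn// -powRD ?subrKC//; apply/implyP => /eqP; lra.
have h1 := @ler_powR_expR R y (q - 2) y0.
have h2 : y ^+ 2 <= expR (y ^+ 2) - 1 by rewrite lerBrDl expR_ge1Dx.
have h3 : 1 <= expR ((q - 2) * y ^+ 2).
  by apply: le_trans (expR_ge1Dx _); rewrite lerDl mulr_ge0 ?sqr_ge0//; lra.
have -> : expR (q * y ^+ 2) = expR (y ^+ 2) * expR (y ^+ 2) * expR ((q - 2) * y ^+ 2).
  by rewrite -!expRD; congr expR; ring.
have h0 : 0 <= y ^+ 2 by exact: sqr_ge0.
have h4 : y ^+ 2 * y `^ (q - 2) <= (expR (y ^+ 2) - 1) * expR ((q - 2) * y ^+ 2).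
  by apply: ler_pM => //; [exact: powR_ge0|apply: h1; lra].
apply: le_trans h4 _; have := le_trans h0 h2.
move: (expR (y ^+ 2)) (expR ((q - 2) * _)) h3 => E F F1 E1.
have : 0 <= E * F * (E - 1) by rewrite !mulr_ge0//; lra.
lra.
Qed.

Lemma luxemburg_Lq u a q : measurable_fun setT u -> luxemburg_ball u a -> 2 <= q ->
  (\int[mu]_x (`|u x| `^ q)%:E <= (q `^ (q / 2) * a `^ q)%:E)%E.
Proof.
move=> mu_ [a0 ua] q2.
have c0 : 0 <= q `^ (q / 2) * a `^ q by rewrite mulr_ge0 ?powR_ge0.
apply: (@le_trans _ _ (\int[mu]_x ((q `^ (q / 2) * a `^ q) * Phi (`|u x| / a))%:E)%E).
  apply: real_integral_le => //.
  - by apply: (measurableT_comp (measurable_powR _)); exact: measurableT_comp.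
  - by apply: measurable_funM => //; exact: measurable_Phi_comp.
  move=> x _; rewrite -mulrA mulrCA.
  have xa : 0 <= `|u x| / a by rewrite divr_ge0// ltW.
  apply: le_trans (ler_wpM2l (powR_ge0 _ _) (powR_le_Phi q2 xa)).
  by rewrite -powRM ?(ltW a0)// mulrC divfK// gt_eqF.
rewrite real_integralZ//; last 2 first.
- exact: measurable_Phi_comp.
- by move=> x _; exact: Phi_ge0.
by rewrite -orlicz_modularE -[leRHS]mule1 lee_wpmul2l.
Qed.

(** With th = u^2 / (2A)^2 <= 1/4, exp th - 1 <= 4 th = u^2 / A^2, whose integral is at most 1. This
    returns from the bounds on the Duhamel term to exp L^2. *)
Lemma luxemburg_Linfty_L2 u A : measurable_fun setT u -> 0 < A ->
  (forall x, `|u x| <= A) -> (\int[mu]_x (u x ^+ 2)%:E <= (A ^+ 2)%:E)%E ->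
  luxemburg_ball u (2 * A).
Proof.
move=> mu_ A0 uA u2; split; first exact: mulr_gt0.
have A2 : 0 < A ^+ 2 by rewrite exprn_gt0.
have Ai : 0 <= (A ^+ 2)^-1 by rewrite invr_ge0 ltW.
apply: (@le_trans _ _ (\int[mu]_x ((A ^+ 2)^-1 * (u x ^+ 2))%:E)%E).
  apply: real_integral_le => //.
  - apply: measurable_funB => //; apply: measurableT_comp => //.
    by apply: measurable_funM => //; exact: measurable_funX.
  - by apply: measurable_funM => //; exact: measurable_funX.
  - move=> x _; rewrite subr_ge0; apply: le_trans (expR_ge1Dx _).
    by rewrite lerDl divr_ge0// sqr_ge0.
  - move=> x _; rewrite exprMn.
    set th := u x ^+ 2 / _.
    have E : (A ^+ 2)^-1 * u x ^+ 2 = 4 * th by rewrite /th; field; rewrite gt_eqF.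
    have th0 : 0 <= th by rewrite divr_ge0 ?sqr_ge0// mulr_ge0 ?sqr_ge0.
    have th1 : 4 * th <= 1.
      rewrite -E mulrC ler_pdivrMr// mul1r -real_normK ?num_real//.
      by rewrite lerXn2r ?nnegrE// ltW.
    rewrite E.
    have := expR_ge1Dx (- th); have := expRxMexpNx_1 th; have := expR_gt0 th.
    move: (expR th) (expR (- th)) => X Y X0 XY Y1.
    have : X * (1 - th) <= 1 by rewrite -XY ler_pM2l//; lra.
    nra.
rewrite real_integralZ//; last 2 first.
- exact: measurable_funX.
- by move=> x _; exact: sqr_ge0.
apply: le_trans (lee_wpmul2l _ u2) _ => //.
by rewrite -EFinM mulVf ?gt_eqF.
Qed.

Lemma luxemburg_heat M t u a : sigma_finite setT mu -> 1 <= M ->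
  (forall s x, 0 < s -> (\int[mu]_y (gauss_kernel s x y)%:E <= M%:E)%E) ->
  0 < t -> measurable_fun setT u -> luxemburg_ball u a ->
  luxemburg_ball (heat mu t u) (M * a).
Proof.
move=> sf M1 mass t0 mu_ [a0 ua]; have M0 : 0 < M by exact: lt_le_trans M1.
split; first exact: mulr_gt0.
have yPa : young (fun z : R => Phi (z / a)).
  split; first by rewrite mul0r young_Phi.1.
  move=> z0 z00; have za : 0 <= z0 / a by rewrite divr_ge0// ltW.
  have [c c0 Hc] := young_Phi.2 _ za.
  exists (c / a) => [|z zge0]; first by rewrite divr_ge0// ltW.
  have := Hc (z / a); rewrite divr_ge0 ?(ltW a0)// => /(_ isT).
  by rewrite -mulrBl mulrA mulrAC.
have mPa : measurable_fun setT (fun z : R => Phi (z / a)).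
  by apply: (measurableT_comp measurable_Phi); exact: measurable_funM.
have h := heat_young sf M1 mass yPa mPa t0 mu_.
rewrite -(orlicz_modularE u a) in h.
apply: le_trans (le_trans h ua).
rewrite orlicz_modularE le_eqVlt; apply/orP; left; apply/eqP.
by apply: eq_integral => x _; rewrite invfM mulrA.
Qed.

End luxemburg.

(** * The nonlinearity: growth at the critical power and continuity in L^1 *)

Section nonlinearity.
Context {R : realType} (f : R -> R) (l Cf lam : R).
Hypotheses (l2 : 2 <= l) (f0 : f 0 = 0) (Cf0 : 0 < Cf) (lam0 : 0 < lam).
Hypothesis f_lip : forall u v : R, `|f u - f v| <=
  Cf * `|u - v| * (`|u| `^ (l - 1) * expR (lam * u ^+ 2) +
                   `|v| `^ (l - 1) * expR (lam * v ^+ 2)).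

(** The surplus |x|^(l-m) is absorbed by the exponential, at the price of a larger rate. *)
Lemma nonlinearity_growth m x : 0 < m -> m <= l ->
  `|f x| <= Cf * `|x| `^ m * expR ((lam + (l - m)) * x ^+ 2).
Proof.
move=> m0 ml; have := f_lip x 0; have l2' := l2.
rewrite f0 !subr0 normr0 powR0; last by rewrite subr_eq0 gt_eqF; lra.
rewrite mul0r addr0 => h; apply: le_trans h _.
have -> : Cf * `|x| * (`|x| `^ (l - 1) * expR (lam * x ^+ 2)) =
   Cf * `|x| `^ m * (`|x| `^ (l - m) * expR (lam * x ^+ 2)).
  have -> : Cf * `|x| * (`|x| `^ (l - 1) * expR (lam * x ^+ 2)) =
     Cf * (`|x| * `|x| `^ (l - 1)) * expR (lam * x ^+ 2) by ring.
  rewrite mulr_powRB1//; last by lra.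
  have -> : `|x| `^ l = `|x| `^ m * `|x| `^ (l - m).
    by rewrite -powRD ?subrKC//; apply/implyP => /eqP; lra.
  ring.
rewrite ler_wpM2l ?mulr_ge0 ?powR_ge0 ?(ltW Cf0)//.
have -> : expR ((lam + (l - m)) * x ^+ 2) = expR ((l - m) * x ^+ 2) * expR (lam * x ^+ 2).
  by rewrite -expRD; congr expR; ring.
rewrite ler_wpM2r ?expR_ge0//.
have := @ler_powR_expR R `|x| (l - m) (normr_ge0 _).
by rewrite real_normK ?num_real// subr_ge0; apply.
Qed.

Lemma nonlinearity_continuous : continuous f.
Proof.
move=> v; apply/cvgrPdist_le => e e0; have l2' := l2.
pose B := (`|v| + 1) `^ (l - 1) * expR (lam * (`|v| + 1) ^+ 2).
have B0 : 0 < B by rewrite mulr_gt0 ?expR_gt0 ?powR_gt0.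
have wB x : `|x| <= `|v| + 1 -> `|x| `^ (l - 1) * expR (lam * x ^+ 2) <= B.
  move=> xv; apply: ler_pM; rewrite ?powR_ge0 ?expR_ge0//.
    by apply: ge0_ler_powR; rewrite ?nnegrE//; lra.
  by rewrite ler_expR ler_pM2l// -real_normK ?num_real// lerXn2r ?nnegrE.
have c0 : 0 < e / (Cf * (2 * B)) by apply: divr_gt0 => //; apply: mulr_gt0 => //; apply: mulr_gt0.
near=> u.
have uv1 : `|v - u| <= 1 by near: u; apply: cvgr_dist_le; [exact: cvg_id|].
have uv2 : `|v - u| <= e / (Cf * (2 * B)).
  by near: u; apply: cvgr_dist_le; [exact: cvg_id|].
have uB : `|u| <= `|v| + 1.
  have := ler_distD 0 u v; rewrite !subr0 => _.
  have -> : u = v - (v - u) by ring.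
  by apply: le_trans (ler_normB _ _) _; rewrite lerD2l.
apply: le_trans (f_lip v u) _.
apply: (@le_trans _ _ (Cf * `|v - u| * (B + B))).
  rewrite ler_wpM2l ?mulr_ge0 ?(ltW Cf0)//.
  by apply: lerD; apply: wB; rewrite ?lerDl.
have cB : 0 < Cf * (2 * B) by apply: mulr_gt0 => //; apply: mulr_gt0.
move: uv2; rewrite (ler_pdivlMr _ _ cB); congr (_ <= _); ring.
Unshelve. all: by end_near.
Qed.

Lemma nonlinearity_measurable : measurable_fun setT f.
Proof. by apply: continuous_measurable_fun; exact: nonlinearity_continuous. Qed.

(** As 2 <= l, the square vanishes at least quadratically at 0: a factor x^2 is bounded by exp(x^2)
    - 1 and the rest by exponentials. So the Lipschitz weight is in L^2 for small functions of exp
    L^2. *)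
Lemma nonlinearity_weight x :
  (`|x| `^ (l - 1) * expR (lam * x ^+ 2)) ^+ 2 <= expR ((2 * l - 3 + 2 * lam) * x ^+ 2) - 1.
Proof.
have l2' := l2; have lam0' := lam0.
have -> : (`|x| `^ (l - 1) * expR (lam * x ^+ 2)) ^+ 2 =
    x ^+ 2 * (`|x| `^ (2 * l - 4) * expR (2 * lam * x ^+ 2)).
  have e1 : (`|x| `^ (l - 1)) ^+ 2 = x ^+ 2 * `|x| `^ (2 * l - 4).
    rewrite -powR_mulrn ?powR_ge0// -powRrM -[x ^+ 2]real_normK ?num_real//.
    rewrite -powR_mulrn// -powRD; first by congr (_ `^ _); ring.
    by apply/implyP => /eqP; lra.
  have e2 : expR (lam * x ^+ 2) ^+ 2 = expR (2 * lam * x ^+ 2).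
    by rewrite -expRM_natr; congr expR; ring.
  rewrite exprMn e1 e2; ring.
have h1 : x ^+ 2 <= expR (x ^+ 2) - 1 by rewrite lerBrDl expR_ge1Dx.
have h2 := @ler_powR_expR R `|x| (2 * l - 4) (normr_ge0 _).
rewrite real_normK ?num_real// in h2.
have {}h2 := h2 (_ : 0 <= 2 * l - 4).
have -> : expR ((2 * l - 3 + 2 * lam) * x ^+ 2) =
   expR (x ^+ 2) * (expR ((2 * l - 4) * x ^+ 2) * expR (2 * lam * x ^+ 2)).
  by rewrite -!expRD; congr expR; ring.
have h3 : 1 <= expR ((2 * l - 4) * x ^+ 2) * expR (2 * lam * x ^+ 2).
  rewrite -expRD; apply: le_trans (expR_ge1Dx _); rewrite lerDl.
  by rewrite -mulrDl mulr_ge0 ?sqr_ge0//; lra.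
have h0 := sqr_ge0 x.
have h4 : x ^+ 2 * (`|x| `^ (2 * l - 4) * expR (2 * lam * x ^+ 2)) <=
  (expR (x ^+ 2) - 1) * (expR ((2 * l - 4) * x ^+ 2) * expR (2 * lam * x ^+ 2)).
  apply: ler_pM => //.
  by rewrite ler_wpM2r ?expR_ge0//; apply: h2; lra.
apply: le_trans h4 _; have := le_trans h0 h1.
move: (expR (x ^+ 2)) (expR _ * expR _) h3 => E F F1 E1.
have : 0 <= E * F * (E - 1) by rewrite !mulr_ge0//; lra.
lra.
Qed.

(** With Z = |u - v| and X, Y the two weights, Z (X + Y) <= Z^2 / e + e (X^2 + Y^2) by completing a
    square. The first term integrates to at most e and each of the others to at most e, whence the
    3. *)
Lemma nonlinearity_L1_dist N (mu : {measure set (N.-tuple R) -> \bar R}) u v eps e :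
  measurable_fun setT u -> measurable_fun setT v ->
  luxemburg_ball mu u eps -> luxemburg_ball mu v eps ->
  (2 * l - 3 + 2 * lam) * eps ^+ 2 <= 1 ->
  luxemburg_ball mu (fun x => u x - v x) e ->
  (\int[mu]_x `|f (u x) - f (v x)|%:E <= (3 * Cf * e)%:E)%E.
Proof.
move=> mu_ mv [eps0 ue] [_ ve] ke [e0 de].
set k := 2 * l - 3 + 2 * lam in ke *.
have k0 : 0 <= k by have := l2; have := lam0; rewrite /k; lra.
have md : measurable_fun setT (fun x => u x - v x) by exact: measurable_funB.
have mf := nonlinearity_measurable.
have mE (w : N.-tuple R -> R) : measurable_fun setT w ->
    measurable_fun setT (fun x => expR (k * w x ^+ 2) - 1).
  move=> mw; apply: measurable_funB => //; apply: measurableT_comp => //.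
  by apply: measurable_funM => //; exact: measurable_funX.
have E0 (w : N.-tuple R -> R) x : 0 <= expR (k * w x ^+ 2) - 1.
  by rewrite subr_ge0; apply: le_trans (expR_ge1Dx _); rewrite lerDl mulr_ge0 ?sqr_ge0.
have me1 := mE _ mu_; have me2 := mE _ mv.
have m2 : measurable_fun setT (fun x => `|u x - v x| `^ 2).
  by apply: (measurableT_comp (measurable_powR _)); exact: measurableT_comp.
apply: (@le_trans _ _ (\int[mu]_x (Cf * (e^-1 * `|u x - v x| `^ 2 +
   e * ((expR (k * u x ^+ 2) - 1) + (expR (k * v x ^+ 2) - 1))))%:E)%E).
  apply: real_integral_le => //.
  - apply: measurableT_comp => //.
    by apply: measurable_funB; exact: (measurableT_comp mf).
  - apply: measurable_funM => //; apply: measurable_funD; first exact: measurable_funM.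
    by apply: measurable_funM => //; exact: measurable_funD.
  move=> x _; apply: le_trans (f_lip _ _) _; rewrite -mulrA ler_wpM2l ?(ltW Cf0)//.
  rewrite powR_mulrn//.
  have := nonlinearity_weight (u x); have := nonlinearity_weight (v x).
  rewrite -/k.
  move: (_ * expR (lam * u x ^+ 2)) (_ * expR (lam * v x ^+ 2)) `|u x - v x|.
  move=> X Y Z hY hX.
  have h : 0 <= e^-1 * (Z - e * (X + Y) / 2) ^+ 2.
    by rewrite mulr_ge0 ?sqr_ge0// invr_ge0 ltW.
  have hE : e^-1 * (Z - e * (X + Y) / 2) ^+ 2 =
     e^-1 * Z ^+ 2 - Z * (X + Y) + e * (X + Y) ^+ 2 / 4.
    by field; rewrite gt_eqF.
  have hXY : e * (X + Y) ^+ 2 / 4 <= e * (X ^+ 2 + Y ^+ 2).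
    rewrite -mulrA ler_pM2l//; have := sqr_ge0 (X - Y); have := sqr_ge0 X; have := sqr_ge0 Y; nra.
  have hF : e * (X ^+ 2 + Y ^+ 2) <= e * (expR (k * u x ^+ 2) - 1 + (expR (k * v x ^+ 2) - 1)).
    by rewrite ler_pM2l// lerD.
  lra.
have e0' := ltW e0.
rewrite real_integralZ ?(ltW Cf0)//; last 2 first.
- apply: measurable_funD; first exact: measurable_funM.
  by apply: measurable_funM => //; exact: measurable_funD.
- move=> x _; apply: addr_ge0; apply: mulr_ge0 => //; first by rewrite invr_ge0.
  exact: addr_ge0.
rewrite real_integralD//; last 4 first.
- exact: measurable_funM.
- by apply: measurable_funM => //; exact: measurable_funD.
- by move=> x _; apply: mulr_ge0 => //; rewrite invr_ge0.
- by move=> x _; apply: mulr_ge0 => //; exact: addr_ge0.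
rewrite real_integralZ ?invr_ge0// real_integralZ//; last 2 first.
- exact: measurable_funD.
- by move=> x _; exact: addr_ge0.
rewrite real_integralD//; try by move=> x _; exact: E0.
have h1 := orlicz_expm1 eps0 mu_ ue k0 ke.
have h2 := orlicz_expm1 eps0 mv ve k0 ke.
have h3 := orlicz_L2 e0 md de.
apply: (@le_trans _ _ (Cf%:E * ((e^-1)%:E * (e `^ 2)%:E + e%:E * (1 + 1)))%E).
  apply: lee_wpmul2l; first by rewrite lee_fin ltW.
  apply: leeD; apply: lee_wpmul2l; rewrite ?lee_fin ?invr_ge0//.
  by apply: leeD; [apply: le_trans h1 _|apply: le_trans h2 _]; rewrite lee_fin.
rewrite -[leLHS]/((Cf * (e^-1 * e `^ 2 + e * (1 + 1)))%:E) lee_fin powR_mulrn//.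
by rewrite le_eqVlt; apply/orP; left; apply/eqP; field; rewrite gt_eqF.
Qed.

End nonlinearity.

(** * Duhamel estimates *)

Section duhamel_estimates.
Context {R : realType} {N : nat} (mu : {measure set (N.-tuple R) -> \bar R}).
Hypotheses (N0 : (0 < N)%N) (mu_sf : sigma_finite setT mu).
Variable M : R.
Hypothesis M1 : 1 <= M.
Hypothesis mass : forall t x, 0 < t -> (\int[mu]_y (gauss_kernel t x y)%:E <= M%:E)%E.
Local Notation leb := (@lebesgue_measure R).
Local Notation S := (measurableTypeR R).
Local Notation n := (N%:R : R).

(** On each half of (0, t) one of the two factors is at most its value at t/2. Adding both bounds
    avoids splitting the integral. *)
Lemma powR_weight_split (a b t s : R) : 0 <= a -> 0 <= b -> 0 < s < t ->
  (t - s) `^ (- a) * s `^ (- b) <=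
  (t / 2) `^ (- a) * s `^ (- b) + (t / 2) `^ (- b) * (t - s) `^ (- a).
Proof.
move=> a0 b0 /andP[s0 st].
have [st2|st2] := leP s (t / 2).
  rewrite -[leLHS]addr0 lerD ?mulr_ge0 ?powR_ge0//.
  by rewrite ler_wpM2r ?powR_ge0// powR_neg_le//; lra.
rewrite -[leLHS]add0r lerD ?mulr_ge0 ?powR_ge0// mulrC.
by rewrite ler_wpM2r ?powR_ge0// powR_neg_le//; lra.
Qed.

Lemma powR_half (t a : R) : 0 < t -> (t / 2) `^ (- a) = 2 `^ a * t `^ (- a).
Proof.
move=> t0; rewrite powRM ?(ltW t0)// mulrC; congr (_ * _).
by rewrite -powR_inv1// -powRrM mulN1r opprK.
Qed.

Variables (P F k : R) (f : R -> R).
Hypotheses (F0 : 0 < F) (k0 : 0 <= k) (P_ge : 2 * (n + 4) <= P).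
Hypothesis mf : measurable_fun setT f.
Local Notation m := (1 + 4 / n).
Hypothesis f_le : forall x, `|f x| <= F * `|x| `^ m * expR (k * x ^+ 2).

Let C1 : R := F * (3 + k * (2 * n)).
(** One constant for both estimates. The powers of 2 come from passing from t/2 to t and from t to 1
    + t; 12 dominates 2 * 4 + 2 * (4/3) of the L^2 case and the smaller sums of the sup case. *)
Let C0 : R := 12 * 2 `^ (n / 4 + 2^-1) * 2 `^ (n / 4).
Definition duhamel_const : R := M * C1 * C0.

Let n1 : 1 <= n. Proof. by rewrite ler1n. Qed.
Let n0 : 0 < n. Proof. exact: lt_le_trans n1. Qed.
Let M0 : 0 < M. Proof. exact: lt_le_trans M1. Qed.
Let C10 : 0 < C1.
Proof. by rewrite mulr_gt0// ltr_wpDr// mulr_ge0// mulr_ge0// ltW. Qed.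

Let C0_12 : 12 * 2 `^ (n / 4) <= C0.
Proof.
rewrite ler_wpM2r ?powR_ge0// -[leLHS]mulr1 ler_wpM2l//.
by rewrite -[leLHS](powRr0 2); apply: ler_powR; rewrite ?ler1n.
Qed.

Let pow2_ge1 : 1 <= 2 `^ (n / 4) :> R.
Proof.
by rewrite -[leLHS](powRr0 2); apply: ler_powR; rewrite ?ler1n//; have := n0; lra.
Qed.

Lemma duhamel_const_gt0 : 0 < duhamel_const.
Proof.
apply: (mulr_gt0 (mulr_gt0 M0 C10)); apply: lt_le_trans C0_12.
by apply: mulr_gt0 => //; exact: powR_gt0.
Qed.

Variables (eps t : R) (u : R -> N.-tuple R -> R).
Hypotheses (eps0 : 0 < eps) (eps1 : eps <= 1) (t0 : 0 < t).
Hypothesis eps_small : 2 * (k * (2 * n)) * eps ^+ 2 <= 1.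
Hypothesis u_class : forall s, 0 <= s < t ->
  small_class mu eps P (eps * (1 + s) `^ (- (n / 4))) (u s).
Hypothesis mH : measurable_fun ((`]0, t[%classic : set S) `*` [set: N.-tuple R] : set (S * N.-tuple R))
  (fun z => heat mu (t - z.1) (f \o u z.1) z.2).

Let e : R := eps `^ m.

Let e0 : 0 < e. Proof. by rewrite powR_gt0. Qed.

Lemma nonlinearity_decay rho s : 1 <= rho -> rho <= 2 * n -> 2 <= m * rho ->
  2 * (m * rho) <= P -> 0 <= s < t ->
  (\int[mu]_x (`|f (u s x)| `^ rho)%:E <=
    ((C1 * e * (1 + s) `^ (- (n / 4 * (m - 2 / rho)))) `^ rho)%:E)%E.
Proof.
move=> rho1 rhon mr2 mrP st; have rho0 : 0 < rho by exact: lt_le_trans rho1.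
have s1 : 1 <= 1 + s by case/andP: st; lra.
have s0 : 0 < 1 + s by lra.
have W1 : (1 + s) `^ (- (n / 4)) <= 1.
  rewrite powRN invf_le1 ?powR_gt0// -[leLHS](powRr0 (1 + s)).
  by apply: ler_powR => //; have := n0; lra.
have w0 : 0 < eps * (1 + s) `^ (- (n / 4)) by rewrite mulr_gt0// powR_gt0.
have w1 : eps * (1 + s) `^ (- (n / 4)) <= 1.
  by rewrite -[leRHS]mulr1 ler_pM ?powR_ge0// ltW.
have krho : 2 * (k * rho) * eps ^+ 2 <= 1.
  apply: le_trans eps_small; rewrite ler_wpM2r ?sqr_ge0// ler_wpM2l//.
  by rewrite ler_wpM2l.
have := class_nonlinearity eps0 w0 (u_class st) w1 (ltW F0) k0 mf f_le rho1 mr2 mrP krho.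
move=> /le_trans; apply; rewrite lee_fin; apply: ge0_ler_powR; rewrite ?nnegrE ?(ltW rho0)//.
- by rewrite !mulr_ge0 ?powR_ge0 ?(ltW F0)// addr_ge0// mulr_ge0// ltW.
- exact: (mulr_ge0 (mulr_ge0 (ltW C10) (ltW e0)) (powR_ge0 _ _)).
have -> : eps `^ (2 / rho) * (eps * (1 + s) `^ (- (n / 4))) `^ (m - 2 / rho) =
   e * (1 + s) `^ (- (n / 4 * (m - 2 / rho))).
  rewrite powRM ?powR_ge0 ?(ltW eps0)// mulrA -powRD; last by rewrite (gt_eqF eps0) implybT.
  by rewrite subrKC -powRrM mulNr.
rewrite -[leRHS]mulrA ler_wpM2r ?(mulr_ge0 (ltW e0) (powR_ge0 _ _))//.
by apply: ler_wpM2l; [exact: ltW|rewrite lerD2l ler_wpM2l].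
Qed.

(** Chosen by (n/2) (1/r - 1/2) = 1/4, the singularity of the semigroup from L^r to L^2; it lies in
    [1, 2) for every n >= 1. *)
Let r : R := 2 * n / (n + 1).
Let r_ge1 : 1 <= r. Proof. by have := n1 => ?; rewrite ler_pdivlMr; lra. Qed.
Let r_le2 : r <= 2. Proof. by have := n1 => ?; rewrite ler_pdivrMr; lra. Qed.
Let mrE : m * r = 2 * (n + 4) / (n + 1).
Proof. by rewrite /r; field; rewrite !gt_eqF//; have := n0; lra. Qed.

Lemma nonlinearity_Lr s : 0 <= s < t ->
  (\int[mu]_x (`|f (u s x)| `^ r)%:E <=
    ((C1 * e * (1 + s) `^ (- (3 / 4))) `^ r)%:E)%E.
Proof.
move=> st; have n1' := n1; have np : 0 < n + 1 by lra.
have -> : 3 / 4 = n / 4 * (m - 2 / r).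
  by rewrite /r; field; rewrite !gt_eqF//; have := n0; lra.
apply: nonlinearity_decay => //.
- by apply: le_trans r_le2 _; lra.
- by rewrite mrE ler_pdivlMr//; lra.
- apply: le_trans P_ge; rewrite mrE mulrA ler_pdivrMr//; nra.
Qed.

Lemma nonlinearity_LN s : 0 <= s < t ->
  (\int[mu]_x (`|f (u s x)| `^ n)%:E <=
    ((C1 * e * (1 + s) `^ (- (n / 4 + 2^-1))) `^ n)%:E)%E.
Proof.
move=> st; have n1' := n1.
have mn : m * n = n + 4 by field; rewrite gt_eqF.
have -> : n / 4 + 2^-1 = n / 4 * (m - 2 / n) by field; rewrite gt_eqF.
apply: nonlinearity_decay => //.
- lra.
- rewrite mn; lra.
- by rewrite mn.
Qed.

Let mfu s : 0 <= s < t -> measurable_fun setT (f \o u s).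
Proof. by move=> /u_class[m1 _ _]; exact: measurableT_comp. Qed.

Let A0 a s : 0 <= C1 * e * (1 + s) `^ a.
Proof. exact: (mulr_ge0 (mulr_ge0 (ltW C10) (ltW e0)) (powR_ge0 _ _)). Qed.

Let D x := Rintegral leb `[0, t] (fun s => heat mu (t - s) (f \o u s) x).

Let DE x : D x = Rintegral leb `]0, t[ (fun s => heat mu (t - s) (f \o u s) x).
Proof. exact: (duhamel_closed (H := fun s x => heat mu (t - s) (f \o u s) x) mH). Qed.

Let mpow_s a : measurable_fun [set: S] (fun s : S => s `^ a).
Proof. exact: measurable_powR. Qed.

Let mpow_ts a : measurable_fun [set: S] (fun s : S => (t - s) `^ a).
Proof.
apply: (measurableT_comp (measurable_powR _)); apply: measurable_funB => //.
Qed.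

Lemma measurable_duhamel_term : measurable_fun setT D.
Proof.
rewrite (_ : D = fun x => Rintegral leb `]0, t[ (fun s => heat mu (t - s) (f \o u s) x)).
  exact: (measurable_duhamel (H := fun s x => heat mu (t - s) (f \o u s) x) mH).
by apply/funext => x; rewrite DE.
Qed.

Let integral_weights a b p q : 0 <= p -> 0 <= q -> a < 1 -> b < 1 ->
  (\int[leb]_(s in `]0%R, t[) (p * s `^ (- a) + q * (t - s) `^ (- b))%:E <=
    (p * (t `^ (1 - a) / (1 - a)) + q * (t `^ (1 - b) / (1 - b)))%:E)%E.
Proof.
move=> p0 q0 a1 b1; have mD : measurable (`]0, t[ : set S) by exact: measurable_itv.
rewrite real_integralD//; last 4 first.
- by apply: measurable_funTS; exact: measurable_funM.
- by apply: measurable_funTS; exact: measurable_funM.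
- by move=> s _; rewrite mulr_ge0 ?powR_ge0.
- by move=> s _; rewrite mulr_ge0 ?powR_ge0.
rewrite !real_integralZ//; try exact: measurable_funTS; try by move=> s _; exact: powR_ge0.
rewrite EFinD !EFinM; apply: leeD; apply: lee_wpmul2l; rewrite ?lee_fin//.
  exact: integral_powR_le.
exact: integral_powR_rev_le.
Qed.

(** The integrand is of order (t-s)^(-1/4) s^(-3/4) once 1 + s is lowered to s; its integral over
    (0, t) is scale invariant, hence bounded uniformly in t. *)
Lemma duhamel_term_L2 : (\int[mu]_x (D x ^+ 2)%:E <= ((duhamel_const * e) ^+ 2)%:E)%E.
Proof.
pose c := M * C1 * e; have c0 : 0 < c by exact: (mulr_gt0 (mulr_gt0 M0 C10) e0).
pose p := c * (t / 2) `^ (- 4^-1); pose q := c * (t / 2) `^ (- (3 / 4)).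
have th : 0 < t / 2 by rewrite divr_gt0.
have p0 : 0 < p by rewrite mulr_gt0// powR_gt0.
have q0 : 0 < q by rewrite mulr_gt0// powR_gt0.
pose b s := p * s `^ (- (3 / 4)) + q * (t - s) `^ (- 4^-1).
have C00 : 0 < C0 by apply: lt_le_trans C0_12; rewrite mulr_gt0// powR_gt0.
under eq_integral do rewrite DE.
apply: (duhamel_L2 mu_sf (H := fun s x => heat mu (t - s) (f \o u s) x) mH (b := b)).
- by apply: measurable_funD; exact: measurable_funM.
- move=> s /andP[s0 st]; rewrite addr_gt0// mulr_gt0// powR_gt0//; lra.
- apply: le_trans (integral_weights (ltW p0) (ltW q0) _ _) _; [lra|lra|].
  rewrite lee_fin /p /q !powR_half// (_ : 1 - 3 / 4 = 4^-1); last by lra.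
  rewrite (_ : 1 - 4^-1 = 3 / 4); last by lra.
  have tt a : t `^ (- a) * t `^ a = 1 by rewrite -powRD ?addNr ?powRr0// (gt_eqF t0) implybT.
  have -> : c * (2 `^ 4^-1 * t `^ (- 4^-1)) * (t `^ 4^-1 / 4^-1) +
     c * (2 `^ (3 / 4) * t `^ (- (3 / 4))) * (t `^ (3 / 4) / (3 / 4)) =
     c * (2 `^ 4^-1 * 4 * (t `^ (- 4^-1) * t `^ 4^-1) +
          2 `^ (3 / 4) * (4 / 3) * (t `^ (- (3 / 4)) * t `^ (3 / 4))) by field.
  rewrite !tt !mulr1.
  have h1 : 2 `^ 4^-1 <= 2 :> R by apply: ler1_powR; rewrite ?ler1n//; lra.
  have h2 : 2 `^ (3 / 4) <= 2 :> R by apply: ler1_powR; rewrite ?ler1n//; lra.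
  rewrite /duhamel_const (_ : M * C1 * C0 * e = c * C0); last by rewrite /c; ring.
  rewrite ler_pM2l//; apply: le_trans C0_12; have := pow2_ge1; lra.
- exact: (mulr_gt0 duhamel_const_gt0 e0).
move=> s s0t; have /andP[s0 st] := s0t.
have st' : 0 <= s < t by rewrite (ltW s0).
have ts0 : 0 < t - s by rewrite subr_gt0.
apply: le_trans (heat_L2 mu_sf M1 mass ts0 r_ge1 (A0 _ s) (mfu st') (nonlinearity_Lr st') r_le2) _.
rewrite lee_fin lerXn2r ?nnegrE//.
- exact: (mulr_ge0 (mulr_ge0 (ltW M0) (powR_ge0 _ _)) (A0 _ s)).
- by rewrite addr_ge0// mulr_ge0 ?powR_ge0// ltW.
have -> : n / 2 * (r^-1 - 2^-1) = 4^-1.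
  by rewrite /r; field; rewrite !gt_eqF//; have := n0; lra.
have h1 : (1 + s) `^ (- (3 / 4)) <= s `^ (- (3 / 4)) by apply: powR_neg_le => //; lra.
apply: (@le_trans _ _ (c * ((t - s) `^ (- 4^-1) * s `^ (- (3 / 4))))).
  rewrite (_ : M * _ * _ = c * ((t - s) `^ (- 4^-1) * (1 + s) `^ (- (3 / 4)))); last by rewrite /c; ring.
  by rewrite ler_pM2l// ler_wpM2l ?powR_ge0.
have := @powR_weight_split 4^-1 (3 / 4) t s; rewrite s0t.
move=> /(_ _ _ isT) h; apply: (@le_trans _ _ (c * ((t / 2) `^ (- 4^-1) * s `^ (- (3 / 4)) +
   (t / 2) `^ (- (3 / 4)) * (t - s) `^ (- 4^-1)))).
  by rewrite ler_pM2l//; apply: h; lra.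
by rewrite /b /p /q le_eqVlt; apply/orP; left; apply/eqP; ring.
Qed.

(* For [t > 1] the L^(2N/(N+1)) bound is used on [s <= t/2], where the kernel is
   smooth but [f (u s)] decays slowly, and the L^N bound on [s > t/2]. *)
Lemma duhamel_term_Linfty x : `|D x| <= duhamel_const * e * (1 + t) `^ (- (n / 4)).
Proof.
pose c := M * C1 * e; have c0 : 0 < c by exact: (mulr_gt0 (mulr_gt0 M0 C10) e0).
have n1' := n1; have t0' := t0.
rewrite DE /duhamel_const (_ : M * C1 * C0 * e = c * C0); last by rewrite /c; ring.
have HN s : 0 < s < t -> `|heat mu (t - s) (f \o u s) x| <=
    c * ((t - s) `^ (- 2^-1) * (1 + s) `^ (- (n / 4 + 2^-1))).
  move=> /andP[s0 st]; have st' : 0 <= s < t by rewrite (ltW s0).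
  have ts0 : 0 < t - s by rewrite subr_gt0.
  apply: le_trans (heat_Linfty M1 mass ts0 n1 (A0 _ s) (mfu st') (nonlinearity_LN st') x) _.
  rewrite (_ : n / (2 * n) = 2^-1); last by field; rewrite gt_eqF.
  by rewrite /c le_eqVlt; apply/orP; left; apply/eqP; ring.
have Hr s : 0 < s < t -> `|heat mu (t - s) (f \o u s) x| <=
    c * ((t - s) `^ (- ((n + 1) / 4)) * (1 + s) `^ (- (3 / 4))).
  move=> /andP[s0 st]; have st' : 0 <= s < t by rewrite (ltW s0).
  have ts0 : 0 < t - s by rewrite subr_gt0.
  apply: le_trans (heat_Linfty M1 mass ts0 r_ge1 (A0 _ s) (mfu st') (nonlinearity_Lr st') x) _.
  rewrite (_ : n / (2 * r) = (n + 1) / 4); last first.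
    by rewrite /r; field; rewrite !gt_eqF//; lra.
  by rewrite /c le_eqVlt; apply/orP; left; apply/eqP; ring.
(* For t <= 1 the weight is comparable to 1, and the L^N bound with singularity (t-s)^(-1/2)
   suffices. *)
have [t1|t1] := leP t 1.
  pose b s := c * (t - s) `^ (- 2^-1).
  apply: (duhamel_Linfty (H := fun s x => heat mu (t - s) (f \o u s) x) mH (b := b)).
  - exact: measurable_funM.
  - have h0 : (2^-1 : R) < 1 by lra.
    have := integral_weights (lexx 0) (ltW c0) ltr01 h0.
    under eq_integral do rewrite mul0r add0r.
    move=> /le_trans; apply; rewrite lee_fin mul0r add0r -mulrA ler_pM2l//.
    have h1 : t `^ (1 - 2^-1) <= 1.
      have e11 : (1 : R) `^ (1 - 2^-1) = 1 by rewrite powR1.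
      by rewrite -[leRHS]e11; apply: ge0_ler_powR; rewrite ?nnegrE//; lra.
    have h2 : 1 <= 2 `^ (n / 4) * (1 + t) `^ (- (n / 4)).
      rewrite powRN ler_pdivlMr ?powR_gt0//; last by lra.
      by rewrite mul1r; apply: ge0_ler_powR; rewrite ?nnegrE//; lra.
    apply: (@le_trans _ _ (12 * 2 `^ (n / 4) * (1 + t) `^ (- (n / 4)))); last first.
      by rewrite ler_wpM2r ?powR_ge0.
    rewrite ler_pdivrMr; last by lra.
    apply: le_trans h1 _; rewrite -[12 * _ * _]mulrA; move: (_ * (1 + t) `^ _) h2 => W W1; lra.
  - move=> s s0t; apply: le_trans (HN s s0t) _; rewrite /b ler_pM2l//.
    rewrite -[leRHS]mulr1 ler_wpM2l ?powR_ge0//.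
    rewrite powRN invf_le1 ?powR_gt0//; last by case/andP: s0t; lra.
    rewrite -[leLHS](powRr0 (1 + s)); apply: ler_powR; last by lra.
    by case/andP: s0t; lra.
(* Each half contributes t^(-n/4): t^(-(n+1)/4) t^(1/4) from the early times and t^(-n/4-1/2)
   t^(1/2) from the late ones. *)
pose p := c * (t / 2) `^ (- ((n + 1) / 4)); pose q := c * (t / 2) `^ (- (n / 4 + 2^-1)).
have th : 0 < t / 2 by rewrite divr_gt0.
have p0 : 0 < p by rewrite mulr_gt0// powR_gt0.
have q0 : 0 < q by rewrite mulr_gt0// powR_gt0.
pose b s := p * s `^ (- (3 / 4)) + q * (t - s) `^ (- 2^-1).
apply: (duhamel_Linfty (H := fun s x => heat mu (t - s) (f \o u s) x) mH (b := b)).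
- by apply: measurable_funD; exact: measurable_funM.
- apply: le_trans (integral_weights (ltW p0) (ltW q0) _ _) _; [lra|lra|].
  rewrite lee_fin /p /q !powR_half// (_ : 1 - 3 / 4 = 4^-1); last by lra.
  rewrite (_ : 1 - 2^-1 = 2^-1 :> R); last by lra.
  have tt1 : t `^ (- ((n + 1) / 4)) * t `^ 4^-1 = t `^ (- (n / 4)).
    by rewrite -powRD ?(gt_eqF t0) ?implybT//; congr (_ `^ _); lra.
  have tt2 : t `^ (- (n / 4 + 2^-1)) * t `^ 2^-1 = t `^ (- (n / 4)).
    by rewrite -powRD ?(gt_eqF t0) ?implybT//; congr (_ `^ _); lra.
  set X := 2 `^ ((n + 1) / 4); set Y := 2 `^ (n / 4 + 2^-1).
  have -> : c * (X * t `^ (- ((n + 1) / 4))) * (t `^ 4^-1 / 4^-1) +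
     c * (Y * t `^ (- (n / 4 + 2^-1))) * (t `^ 2^-1 / 2^-1) =
     c * (X * 4 * (t `^ (- ((n + 1) / 4)) * t `^ 4^-1) +
          Y * 2 * (t `^ (- (n / 4 + 2^-1)) * t `^ 2^-1)) by field.
  rewrite tt1 tt2 -mulrDl -[leRHS]mulrA ler_pM2l//.
  have XY : X <= Y by apply: ler_powR; rewrite ?ler1n//; lra.
  have h : t `^ (- (n / 4)) <= 2 `^ (n / 4) * (1 + t) `^ (- (n / 4)).
    by rewrite -powR_half//; [apply: powR_neg_le => //; lra|lra].
  have Y0 : 0 <= Y by exact: powR_ge0.
  apply: (@le_trans _ _ (12 * Y * (2 `^ (n / 4) * (1 + t) `^ (- (n / 4))))).
    by have X0 : 0 <= X := powR_ge0 _ _; apply: ler_pM; [lra|exact: powR_ge0|lra|exact: h].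
  by rewrite /C0 -/Y mulrA.
- move=> s s0t; have /andP[s0 st] := s0t; rewrite /b /p /q.
  have [st2|st2] := leP s (t / 2).
    apply: le_trans (Hr s s0t) _; rewrite -[leLHS]addr0 lerD//; last first.
      by rewrite mulr_ge0 ?powR_ge0// ltW.
    rewrite -mulrA ler_pM2l// ler_pM ?powR_ge0//; apply: powR_neg_le; lra.
  apply: le_trans (HN s s0t) _; rewrite -[leLHS]add0r lerD//.
    by rewrite mulr_ge0 ?powR_ge0// ltW.
  rewrite -mulrA ler_pM2l// mulrC ler_wpM2r ?powR_ge0//; apply: powR_neg_le; lra.
Qed.

End duhamel_estimates.

(** * The continuity argument *)

Section bootstrap.
Context {R : realType} {N : nat} (mu : {measure set (N.-tuple R) -> \bar R}).
Hypotheses (N0 : (0 < N)%N) (mu_sf : sigma_finite setT mu).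
Variable M : R.
Hypothesis M1 : 1 <= M.
Hypothesis mass : forall t x, 0 < t -> (\int[mu]_y (gauss_kernel t x y)%:E <= M%:E)%E.
Local Notation leb := (@lebesgue_measure R).
Local Notation n := (N%:R : R).
Local Notation T := (N.-tuple R).

Let n1 : 1 <= n. Proof. by rewrite ler1n. Qed.
Let M0 : 0 < M. Proof. exact: lt_le_trans M1. Qed.

Lemma measurable_powR_norm (g : T -> R) q : measurable_fun setT g ->
  measurable_fun setT (fun x => `|g x| `^ q).
Proof.
by move=> mg; apply: (measurableT_comp (measurable_powR _)); exact: measurableT_comp.
Qed.

Lemma Linfty_L2_LP (P c w : R) (g : T -> R) : 2 <= P -> 0 <= c -> 0 <= w ->
  measurable_fun setT g -> (forall x, `|g x| <= c * w) ->
  (\int[mu]_x (g x ^+ 2)%:E <= (c ^+ 2)%:E)%E ->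
  (\int[mu]_x (`|g x| `^ P)%:E <= (c `^ P * w `^ (P - 2))%:E)%E.
Proof.
move=> P2 c0 w0 mg gcw g2.
have cE : c `^ P = c `^ (P - 2) * c ^+ 2.
  by rewrite -powR_mulrn// -powRD ?subrK//; apply/implyP => /eqP; lra.
apply: (@le_trans _ _ (\int[mu]_x ((c * w) `^ (P - 2) * g x ^+ 2)%:E)%E).
  apply: real_integral_le => //.
  - exact: measurable_powR_norm.
  - by apply: measurable_funM => //; exact: measurable_funX.
  move=> x _; have -> : `|g x| `^ P = `|g x| `^ (P - 2) * g x ^+ 2.
    rewrite -[g x ^+ 2]real_normK ?num_real// -powR_mulrn// -powRD ?subrK//.
    by apply/implyP => /eqP; lra.
  rewrite ler_wpM2r ?sqr_ge0// ge0_ler_powR ?nnegrE ?subr_ge0//.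
  exact: mulr_ge0.
rewrite real_integralZ ?powR_ge0//; last 2 first.
- exact: measurable_funX.
- by move=> x _; exact: sqr_ge0.
apply: le_trans (lee_wpmul2l _ g2) _; first by rewrite lee_fin powR_ge0.
rewrite -EFinM lee_fin cE powRM//.
by rewrite le_eqVlt; apply/orP; left; apply/eqP; ring.
Qed.

(** A crude substitute for Minkowski: 2^P from the larger of the two functions and a further 2 <=
    2^P from the sum. On the level of norms the loss is a factor 4. *)
Lemma LP_add (P a : R) (g h : T -> R) : 1 <= P -> 0 <= a ->
  measurable_fun setT g -> measurable_fun setT h ->
  (\int[mu]_x (`|g x| `^ P)%:E <= a%:E)%E ->
  (\int[mu]_x (`|h x| `^ P)%:E <= a%:E)%E ->
  (\int[mu]_x (`|g x + h x| `^ P)%:E <= (4 `^ P * a)%:E)%E.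
Proof.
move=> P1 a0 mg mh ga ha; have P0 : 0 < P by lra.
have mgP := measurable_powR_norm P mg.
have mhP := measurable_powR_norm P mh.
apply: (@le_trans _ _ (\int[mu]_x (2 `^ P * (`|g x| `^ P + `|h x| `^ P))%:E)%E).
  apply: real_integral_le => //.
  - by apply: (measurable_powR_norm P (g := fun x => g x + h x)); exact: measurable_funD.
  - by apply: measurable_funM => //; exact: measurable_funD.
  move=> x _; wlog gh : g h {mg mh ga ha mgP mhP} / `|g x| <= `|h x|.
    move=> W; have [gh|/ltW gh] := leP `|g x| `|h x|; first exact: W.
    by rewrite addrC [X in _ <= _ * X]addrC; exact: W.
  apply: (@le_trans _ _ (2 `^ P * `|h x| `^ P)); last first.
    by rewrite ler_wpM2l ?powR_ge0// lerDr powR_ge0.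
  rewrite -powRM// ge0_ler_powR ?nnegrE ?(ltW P0) ?mulr_ge0//.
  by apply: le_trans (ler_normD _ _) _; lra.
rewrite real_integralZ ?powR_ge0//; last exact: measurable_funD.
rewrite real_integralD//.
apply: (@le_trans _ _ ((2 `^ P)%:E * (a%:E + a%:E))%E).
  by apply: lee_wpmul2l; [rewrite lee_fin powR_ge0|apply: leeD; [exact: ga|exact: ha]].
rewrite -[leLHS]/((2 `^ P * (a + a))%:E) lee_fin.
have -> : 4 = 2 * 2 :> R by lra.
rewrite powRM// -!mulrA ler_wpM2l ?powR_ge0//.
have : (2 : R) <= 2 `^ P by apply: le1r_powR => //; rewrite ler1n.
have -> : a + a = 2 * a by ring.
by move=> h2; rewrite ler_wpM2r.
Qed.

Variables (P : R).
Hypothesis P_ge : 2 * (n + 4) <= P.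

Let P2 : 2 <= P. Proof. by have := n1; have := P_ge; lra. Qed.

Definition decay_weight (t : R) : R := (1 + t) `^ (- (n / 4)).

Local Notation W := decay_weight.

Lemma decay_weight_gt0 t : 0 <= t -> 0 < W t.
Proof. by move=> t0; rewrite powR_gt0//; lra. Qed.

Lemma class_boundE c t : 0 < c ->
  c `^ 2 * (c * W t) `^ (P - 2) = c `^ P * W t `^ (P - 2).
Proof.
move=> c0; rewrite powRM ?powR_ge0 ?(ltW c0)// mulrA -powRD; last by rewrite (gt_eqF c0) implybT.
by rewrite subrKC.
Qed.

(** P is the cost of passing from exp L^2 to L^P, M that of the kernel mass, and 2^(n/4) that of
    inserting the weight in 1 + t. *)
Definition linear_const : R := P * M * 2 `^ (n / 4).

Let pow2_ge1 : 1 <= 2 `^ (n / 4) :> R.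
Proof.
by rewrite -[leLHS](powRr0 2); apply: ler_powR; rewrite ?ler1n//; have := n1; lra.
Qed.

Lemma linear_const_ge : P <= linear_const /\ M <= linear_const.
Proof.
have P2' := P2; have M1' := M1; have h := pow2_ge1; rewrite /linear_const; split.
  by rewrite -mulrA ler_peMr//; [lra|rewrite -[leLHS]mulr1 ler_pM].
by rewrite mulrAC ler_peMl// ?(ltW M0)// -[leLHS]mulr1 ler_pM//; lra.
Qed.

Lemma luxemburg_LP (g : T -> R) a : measurable_fun setT g -> luxemburg_ball mu g a ->
  (\int[mu]_x (`|g x| `^ P)%:E <= ((P * a) `^ P)%:E)%E.
Proof.
move=> mg ga; have P2' := P2; have [a0 _] := ga.
apply: le_trans (luxemburg_Lq mg ga P2) _.
rewrite lee_fin powRM ?(ltW a0)//; last by lra.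
by rewrite ler_wpM2r ?powR_ge0//; apply: ler_powR; lra.
Qed.

(** For t <= 1 the exp L^2 bound is propagated and the weight is comparable to 1; for t > 1 the L^2
    bound and the decay from L^2 to L^oo are combined. *)
Lemma heat_LP (g : T -> R) a t : 0 < t -> measurable_fun setT g ->
  luxemburg_ball mu g a ->
  (\int[mu]_x (`|heat mu t g x| `^ P)%:E <=
     ((linear_const * a) `^ P * W t `^ (P - 2))%:E)%E.
Proof.
move=> t0 mg ga; have [a0 ga1] := ga; have P2' := P2; have n1' := n1.
have mh := measurable_heat mu_sf t0 mg.
have h2 := pow2_ge1.
have Ma : 0 < M * a by rewrite mulr_gt0.
have [t1|t1] := leP t 1.
  have gh := luxemburg_heat mu_sf M1 mass t0 mg ga.
  apply: le_trans (luxemburg_LP mh gh) _.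
  have W2 : 1 <= 2 `^ (n / 4) * W t.
    rewrite /W powRN ler_pdivlMr ?powR_gt0//; last by lra.
    by rewrite mul1r; apply: ge0_ler_powR; rewrite ?nnegrE//; lra.
  have -> : linear_const * a = P * (M * a) * 2 `^ (n / 4) by rewrite /linear_const; ring.
  have c0 : 0 <= P * (M * a) by rewrite mulr_ge0 ?(ltW Ma)//; lra.
  rewrite lee_fin (powRM _ c0 (powR_ge0 _ _)) -mulrA.
  rewrite -[leLHS]mulr1 ler_wpM2l ?powR_ge0//.
  apply: (@le_trans _ _ ((2 `^ (n / 4)) `^ (P - 2) * W t `^ (P - 2))).
    rewrite -powRM ?powR_ge0//.
    by rewrite -[leLHS](powRr0 (2 `^ (n / 4) * W t)); apply: ler_powR => //; lra.
  by rewrite ler_wpM2r ?powR_ge0//; apply: ler_powR => //; lra.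
have g2 := orlicz_L2 a0 mg ga1.
have r21 : (1 : R) <= 2 by lra.
have hb x : `|heat mu t g x| <= M * a * 2 `^ (n / 4) * W t.
  apply: le_trans (heat_Linfty M1 mass t0 r21 (ltW a0) mg g2 x) _.
  rewrite mulrAC -[leRHS]mulrA ler_pM2l// /W -powR_half; last by lra.
  have -> : n / (2 * 2) = n / 4 by lra.
  by apply: powR_neg_le; lra.
have hl2 : (\int[mu]_x (heat mu t g x ^+ 2)%:E <= ((M * a * 2 `^ (n / 4)) ^+ 2)%:E)%E.
  apply: le_trans (heat_L2 mu_sf M1 mass t0 r21 (ltW a0) mg g2 (lexx _)) _.
  rewrite lee_fin subrr mulr0 oppr0 powRr0 mulr1 lerXn2r ?nnegrE ?(ltW Ma)//.
    by rewrite mulr_ge0 ?powR_ge0 ?(ltW Ma).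
  by rewrite ler_peMr// ltW.
have c0 : 0 <= M * a * 2 `^ (n / 4) by rewrite mulr_ge0 ?powR_ge0 ?(ltW Ma).
apply: le_trans (Linfty_L2_LP P2 c0 (powR_ge0 _ _) mh hb hl2) _.
rewrite lee_fin ler_wpM2r ?powR_ge0//; apply: ge0_ler_powR; rewrite ?nnegrE//.
- lra.
- by rewrite mulr_ge0// ?(ltW a0)// /linear_const !mulr_ge0 ?powR_ge0 ?(ltW M0)//; lra.
rewrite /linear_const (_ : P * M * _ * a = P * (M * a * 2 `^ (n / 4))); last by ring.
by rewrite ler_peMl//; lra.
Qed.

Variables (l : R) (f : R -> R) (Cf lam : R).
Local Notation m := (1 + 4 / n).
Hypotheses (ml : m <= l) (l2 : 2 <= l) (f0 : f 0 = 0) (Cf0 : 0 < Cf) (lam0 : 0 < lam).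
Hypothesis f_lip : forall u v : R, `|f u - f v| <=
     Cf * `|u - v| * (`|u| `^ (l - 1) * expR (lam * u ^+ 2) +
                      `|v| `^ (l - 1) * expR (lam * v ^+ 2)).

Let k : R := lam + (l - m).
Let k0 : 0 <= k. Proof. by rewrite addr_ge0 ?subr_ge0// ltW. Qed.
Let m0 : 0 < m. Proof. by have := n1 => ?; rewrite addr_gt0// divr_gt0//; lra. Qed.
Let mf := nonlinearity_measurable l2 Cf0 lam0 f_lip.
Let f_le x := @nonlinearity_growth R f l Cf lam l2 f0 Cf0 f_lip m x m0 ml.

Let Cd : R := duhamel_const M Cf k (N := N).
Let Cd0 : 0 < Cd. Proof. exact: duhamel_const_gt0. Qed.

Variable eps : R.
Hypotheses (eps0 : 0 < eps) (eps1 : eps <= 1).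
Hypothesis eps_k : 2 * (k * (2 * n)) * eps ^+ 2 <= 1.
Hypothesis eps_l : (2 * l - 3 + 2 * lam) * eps ^+ 2 <= 1.

Variables (u0 : T -> R) (u : R -> T -> R).
Hypothesis mu0 : measurable_fun setT u0.
Hypothesis um : forall t, 0 <= t -> measurable_fun setT (u t).
Hypothesis uc : forall t, 0 <= t -> forall e, 0 < e -> exists2 dl : R, 0 < dl &
    forall s, 0 <= s -> `|s - t| < dl -> luxemburg_ball mu (fun x => u s x - u t x) e.
Hypothesis mild : forall t, 0 <= t ->
    {ae mu, forall x, u t x = heat mu t u0 x +
       Rintegral leb `[0, t] (fun s => heat mu (t - s) (f \o u s) x)}.

Let Q t := small_class mu eps P (eps * W t) (u t).

Lemma heat_path_measurable_of_class t : (forall s, 0 <= s < t -> Q s) ->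
  measurable_fun ((`]0, t[%classic : set (measurableTypeR R)) `*` [set: T] :
      set (measurableTypeR R * T))
    (fun z => heat mu (t - z.1) (f \o u z.1) z.2).
Proof.
move=> Qs; apply: (@measurable_heat_path R N mu mu_sf t (fun s => f \o u s)).
- by move=> s st; apply: measurableT_comp => //; case: (Qs s st).
- move=> s st; have [ms us _] := Qs s st.
  have z1 : luxemburg_ball mu (cst 0) eps.
    split; first exact: eps0.
    rewrite orlicz_modularE.
    by rewrite integral0_eq// => x _; rewrite normr0 mul0r young_Phi.1.
  have d1 : luxemburg_ball mu (fun x => u s x - 0) eps.
    split; first exact: eps0.
    by under eq_fun do rewrite subr0.
  have := @nonlinearity_L1_dist R f l Cf lam l2 Cf0 lam0 f_lip N mu (u s) (cst 0) eps eps ms.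
  move=> /(_ (measurable_cst _) (conj eps0 us) z1 eps_l d1).
  under eq_integral do rewrite f0 subr0.
  by move=> /le_lt_trans; apply; exact: ltry.
- move=> s /andP[s0 st] e e0.
  have e3 : 0 < e / (3 * Cf) by rewrite divr_gt0// mulr_gt0.
  have [dl dl0 Hdl] := uc (ltW s0) e3.
  exists dl => // s' s't ss'; have /andP[s'0 _] := s't.
  have st' : 0 <= s < t by rewrite (ltW s0).
  have [ms us _] := Qs s st'; have [ms' us' _] := Qs s' s't.
  have := @nonlinearity_L1_dist R f l Cf lam l2 Cf0 lam0 f_lip N mu (u s') (u s) eps _ ms' ms.
  move=> /(_ _ (conj eps0 us') (conj eps0 us) eps_l (Hdl s' s'0 ss')).
  by rewrite mulrC divfK// gt_eqF// mulr_gt0.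
Qed.

Let D t x := Rintegral leb `[0, t] (fun s => heat mu (t - s) (f \o u s) x).

Lemma bootstrap_duhamel t : 0 < t -> (forall s, 0 <= s < t -> Q s) ->
  [/\ measurable_fun setT (D t),
      forall x, `|D t x| <= Cd * eps `^ m * W t &
      (\int[mu]_x (D t x ^+ 2)%:E <= ((Cd * eps `^ m) ^+ 2)%:E)%E].
Proof.
move=> t0 Qs; have mH := heat_path_measurable_of_class Qs; split.
- exact: measurable_duhamel_term mH.
- move=> x; exact: (duhamel_term_Linfty N0 M1 mass Cf0 k0 P_ge mf f_le eps0 eps1 t0 eps_k Qs mH).
- exact: (duhamel_term_L2 N0 mu_sf M1 mass Cf0 k0 P_ge mf f_le eps0 eps1 t0 eps_k Qs mH).
Qed.

(** The reciprocal of the two losses in [bootstrap_open]: 4 from adding in L^P and 2^(n/4) from the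
    change of the weight over a time at most 1. The radius [a] lets the linear flow use a quarter of
    eta eps. *)
Let eta : R := (4 * 2 `^ (n / 4))^-1.
Let a : R := eta * eps / (4 * linear_const).

Let eta0 : 0 < eta. Proof. by rewrite invr_gt0 mulr_gt0// powR_gt0. Qed.
Let eta_le : eta <= 4^-1.
Proof. by rewrite lef_pV2 ?posrE ?mulr_gt0 ?powR_gt0// ler_peMr. Qed.

Let L0 : 0 < linear_const.
Proof. by have [_ h] := linear_const_ge; exact: lt_le_trans h. Qed.

Let a0 : 0 < a.
Proof. by have h4 : (0 : R) < 4 by []; exact: (divr_gt0 (mulr_gt0 eta0 eps0) (mulr_gt0 h4 L0)). Qed.

Let La : 4 * (linear_const * a) = eta * eps.
Proof. by rewrite /a; field; rewrite gt_eqF. Qed.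

Hypothesis u0a : luxemburg_ball mu u0 a.
Hypothesis eps_Cd : Cd * eps `^ m <= eta / 4 * eps.

(** The improved bounds: half the radius in exp L^2, and [eta * eps] for [eps] in the L^P bound with
    the same weight. *)
Let Q' t := luxemburg_ball mu (u t) (eps / 2) /\
  (\int[mu]_x (`|u t x| `^ P)%:E <= ((eta * eps) `^ P * W t `^ (P - 2))%:E)%E.

(** The mild formula at t involves only earlier times, so the class on [0, t) yields the improved
    bounds at t itself; no separate closedness argument is required. *)
Lemma bootstrap_improve t : 0 <= t -> (forall s, 0 <= s < t -> Q s) -> Q' t.
Proof.
rewrite le_eqVlt => /predU1P[<-|t0] Qs.
  have e0 : {ae mu, forall x, u0 x = u 0 x}.
    have := mild (lexx 0); apply: filterS => x ->.
    (* At t = 0 the semigroup is the identity and the integral runs over one point. *)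
    by rewrite /heat eqxx set_itv1 Rintegral_set1 addr0.
  have u00 := luxemburg_ball_ae mu0 (um (lexx 0)) e0 u0a.
  have [PL ML] := linear_const_ge; have La' := La; have eta_le' := eta_le.
  have Pa : P * a <= eta * eps.
    apply: (@le_trans _ _ (linear_const * a)); first exact: (ler_wpM2r (ltW a0) PL).
    by have := mulr_ge0 (ltW L0) (ltW a0); lra.
  split.
    apply: luxemburg_ball_le (um (lexx 0)) u00 _.
    have P2' := P2.
    apply: (@le_trans _ _ (P * a)); first by rewrite ler_peMl ?(ltW a0)//; lra.
    apply: le_trans Pa _; rewrite mulrC ler_pM2l//; lra.
  apply: le_trans (luxemburg_LP (um (lexx 0)) u00) _.
  have -> : W 0 = 1 by rewrite /W addr0 powR1.
  rewrite powR1 mulr1 lee_fin; have P2' := P2.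
  have P0' : 0 <= P by lra.
  have Pa0 : 0 <= P * a := mulr_ge0 P0' (ltW a0).
  apply: ge0_ler_powR; [exact: P0'|by rewrite nnegrE; exact: Pa0| |exact: Pa].
  by rewrite nnegrE; exact: le_trans Pa0 Pa.
have [mD Db D2] := bootstrap_duhamel t0 Qs.
have e0 : {ae mu, forall x, heat mu t u0 x + D t x = u t x}.
  by have := mild (ltW t0); apply: filterS => x ->.
have mh := measurable_heat mu_sf t0 mu0.
have mhD : measurable_fun setT (fun x => heat mu t u0 x + D t x) by exact: measurable_funD.
have mut := um (ltW t0).
have c0 : 0 < Cd * eps `^ m by rewrite mulr_gt0// powR_gt0.
have W1 : W t <= 1.
  rewrite /W powRN invf_le1 ?powR_gt0//; last by lra.
  by rewrite -[leLHS](powRr0 (1 + t)); apply: ler_powR; have := n1; lra.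
have lD : luxemburg_ball mu (D t) (2 * (Cd * eps `^ m)).
  apply: luxemburg_Linfty_L2 => // x; apply: le_trans (Db x) _.
  by rewrite ler_piMr// ltW.
have lh := luxemburg_heat mu_sf M1 mass t0 mu0 u0a.
have [PL ML] := linear_const_ge.
have La' := La; have eta_le' := eta_le; have ec := eps_Cd.
have ee : eta * eps <= 4^-1 * eps by rewrite ler_pM2r.
split.
  apply: (luxemburg_ball_ae mhD mut e0).
  apply: (luxemburg_ball_le mhD (luxemburg_ballD mh mD lh lD)).
  have : M * a <= linear_const * a by exact: (ler_wpM2r (ltW a0) ML).
  lra.
have -> : (\int[mu]_x (`|u t x| `^ P)%:E = \int[mu]_x (`|heat mu t u0 x + D t x| `^ P)%:E)%E.
  apply: ae_eq_integral => //.
  - by apply/measurable_EFinP; exact: measurable_powR_norm.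
  - by apply/measurable_EFinP; exact: measurable_powR_norm.
  - by apply: filterS e0 => x -> _.
(* A quarter for each of the linear and the Duhamel term, since [LP_add] multiplies by 4. *)
pose c := eta * eps / 4.
have cp : 0 < c by rewrite divr_gt0// mulr_gt0.
have P2' := P2.
have cc b : 0 <= b -> b <= c -> b `^ P * W t `^ (P - 2) <= c `^ P * W t `^ (P - 2).
  move=> b0 bc; rewrite ler_wpM2r ?powR_ge0// ge0_ler_powR ?nnegrE ?(ltW cp)//; lra.
have i1 : (\int[mu]_x (`|heat mu t u0 x| `^ P)%:E <= (c `^ P * W t `^ (P - 2))%:E)%E.
  apply: le_trans (heat_LP t0 mu0 u0a) _; rewrite lee_fin; apply: cc.
    by rewrite mulr_ge0 ?(ltW L0) ?(ltW a0).
  rewrite /c; lra.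
have i2 : (\int[mu]_x (`|D t x| `^ P)%:E <= (c `^ P * W t `^ (P - 2))%:E)%E.
  apply: le_trans (Linfty_L2_LP P2 (ltW c0) (powR_ge0 _ _) mD Db D2) _.
  rewrite lee_fin; apply: cc; first exact: ltW.
  rewrite /c; lra.
have P1 : 1 <= P by lra.
have cW : 0 <= c `^ P * W t `^ (P - 2) by rewrite mulr_ge0 ?powR_ge0.
apply: le_trans (LP_add P1 cW mh mD i1 i2) _.
rewrite lee_fin mulrA -powRM ?(ltW cp)//.
by rewrite /c (_ : 4 * _ = eta * eps)//; lra.
Qed.

Lemma bootstrap_open t : 0 <= t -> Q' t -> exists2 dl : R, 0 < dl &
  forall s, t <= s -> s < t + dl -> Q s.
Proof.
move=> t0 [ut uP]; have n1' := n1; have P2' := P2.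
have W0 := decay_weight_gt0 t0.
pose c := eta * eps * W t.
have c0 : 0 < c by rewrite !mulr_gt0.
(* Radius eps/2 completes that of [u t] to eps; radius c/P becomes c in L^P through
   [luxemburg_LP]. *)
have e1 : 0 < Num.min (eps / 2) (c / P).
  by rewrite lt_min !divr_gt0//; lra.
have [dl dl0 Hdl] := uc t0 e1.
exists (Num.min 1 dl) => [|s ts]; first by rewrite lt_min ltr01.
rewrite -ltrBlDl lt_min => /andP[s1 sdl].
have s0 : 0 <= s := le_trans t0 ts.
have ls : luxemburg_ball mu (fun x => u s x - u t x) (Num.min (eps / 2) (c / P)).
  by apply: Hdl => //; rewrite ger0_norm ?subr_ge0.
have ms := um s0; have mt := um t0.
have md : measurable_fun setT (fun x => u s x - u t x) by exact: measurable_funB.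
have uE : u s = fun x => u t x + (u s x - u t x) by apply/funext => x; rewrite subrKC.
split=> //.
  have l1 := luxemburg_ball_le md ls (_ : _ <= eps / 2).
  have [] := luxemburg_ballD mt md ut (l1 _); first by rewrite ge_min lexx.
  by rewrite -uE -splitr.
have ldP : (\int[mu]_x (`|u s x - u t x| `^ P)%:E <= ((eta * eps) `^ P * W t `^ (P - 2))%:E)%E.
  have l1 : luxemburg_ball mu (fun x => u s x - u t x) (c / P).
    by apply: luxemburg_ball_le md ls _; rewrite ge_min lexx orbT.
  apply: le_trans (luxemburg_LP md l1) _.
  rewrite mulrC divfK; last by rewrite gt_eqF//; lra.
  rewrite lee_fin /c powRM ?powR_ge0 ?mulr_ge0 ?(ltW eta0) ?(ltW eps0)//.
  rewrite ler_wpM2l ?powR_ge0//.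
  have Wt1 : W t <= 1.
    rewrite /W powRN invf_le1 ?powR_gt0//; last by lra.
    by rewrite -[leLHS](powRr0 (1 + t)); apply: ler_powR; lra.
  by apply: ger_powR; rewrite ?W0//; lra.
have P1 : 1 <= P by lra.
have cW : 0 <= (eta * eps) `^ P * W t `^ (P - 2) by rewrite mulr_ge0 ?powR_ge0.
under eq_integral => x _ do rewrite -[u s x](subrKC (u t x)).
apply: le_trans (LP_add P1 cW mt md uP ldP) _.
have ee0 : 0 <= eta * eps := mulr_ge0 (ltW eta0) (ltW eps0).
have h4 : (0 : R) <= 4 by [].
rewrite lee_fin (@class_boundE eps s eps0) mulrA -(powRM P h4 ee0).
pose b : R := 2 `^ (n / 4).
have b0 : 0 < b by rewrite powR_gt0.
have bi0 : 0 < b^-1 by rewrite invr_gt0.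
have -> : 4 * (eta * eps) = b^-1 * eps by rewrite /eta -/b; field; rewrite gt_eqF.
have Wts : W t <= b * W s.
  rewrite /b /W -powR_half; last by lra.
  by apply: powR_neg_le; lra.
apply: (@le_trans _ _ ((b^-1 * eps) `^ P * (b * W s) `^ (P - 2))).
  rewrite ler_wpM2l ?powR_ge0// ge0_ler_powR ?nnegrE ?(ltW W0)//; first lra.
  by rewrite mulr_ge0 ?powR_ge0// ltW.
rewrite (powRM P (ltW bi0) (ltW eps0)) (powRM (P - 2) (ltW b0) (ltW (decay_weight_gt0 s0))).
(* The factor 1/b left in [eta] is raised to P while the weight only loses b^(P-2), so b^(-2) <= 1
   remains. *)
have bb : (b^-1) `^ P * b `^ (P - 2) <= 1.
  rewrite -powR_inv1 ?(ltW b0)// -powRrM mulN1r -powRD; last by rewrite (gt_eqF b0) implybT.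
  rewrite -[leRHS](powRr0 b); apply: ler_powR; first exact: pow2_ge1.
  lra.
have eW : 0 <= eps `^ P * W s `^ (P - 2) by rewrite mulr_ge0 ?powR_ge0.
have := ler_wpM2r eW bb; rewrite mul1r; apply: le_trans.
move: (b^-1 `^ P) (eps `^ P) (b `^ (P - 2)) (W s `^ (P - 2)) => X Y Z V.
by rewrite mulrACA.
Qed.

(** Failure at t bounds the set A of those s for which the class holds on [0, s). As these intervals
    are half-open, the class holds on [0, sup A); improving at sup A and moving past it contradicts
    the supremum. *)
Lemma bootstrap_class t : 0 <= t -> Q t.
Proof.
move=> t0; apply: contrapT => nQ.
pose A : set R := [set s | 0 <= s /\ forall r, 0 <= r < s -> Q r].
have A0 : A 0 by split=> // r /andP[r0 /(le_lt_trans r0)]; rewrite ltxx.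
have Aub : ubound A t.
  by move=> s [s0 Qs]; rewrite leNgt; apply/negP => ts; apply/nQ/Qs; rewrite t0.
have hA : has_sup A by split; [exists 0|exists t].
pose s := sup A.
have s0 : 0 <= s by apply: sup_ubound => //; exact: (proj2 hA).
have Qs r : 0 <= r < s -> Q r.
  move=> /andP[r0 rs]; have [y [y0 Qy] ry] := sup_gt (proj1 hA) rs.
  by apply: Qy; rewrite r0.
have [dl dl0 Hdl] := bootstrap_open s0 (bootstrap_improve s0 Qs).
have : A (s + dl).
  split=> [|r /andP[r0 rs]]; first by rewrite addr_ge0// ltW.
  have [rs'|sr] := ltP r s; first by apply: Qs; rewrite r0.
  exact: Hdl.
move=> /(sup_ubound (proj2 hA)); rewrite -/s; lra.
Qed.

(** For p = oo: the sup bound concerns the Duhamel term alone, and the linear part is kept as it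
    is. *)
Lemma bootstrap_pointwise t : 0 < t ->
  {ae mu, forall x, `|u t x| <= `|heat mu t u0 x| + Cd * eps `^ m * W t}.
Proof.
move=> t0; have Qs s : 0 <= s < t -> Q s by move=> /andP[s0 _]; exact: bootstrap_class.
have [_ Db _] := bootstrap_duhamel t0 Qs.
have := mild (ltW t0); apply: filterS => x ->.
by apply: le_trans (ler_normD _ _) _; rewrite lerD2l; exact: Db.
Qed.

End bootstrap.

(** * Decay in Lebesgue norms *)

Section decay_lemmas.
Context {R : realType} {N : nat}.
Local Notation n := (N%:R : R).

Lemma small_eps_exists (X Cd c : R) : (0 < N)%N -> 0 <= X -> 0 < Cd -> 0 < c ->
  exists2 eps : R, 0 < eps <= 1 &
    X * eps ^+ 2 <= 1 /\ Cd * eps `^ (1 + 4 / n) <= c * eps.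
Proof.
move=> N0 X0 Cd0 c0; have n0 : 0 < n by rewrite ltr0n.
(* The second inequality amounts to eps^(4/n) <= c / Cd, that is eps <= y; here m > 1 is used. *)
pose y := (c / Cd) `^ (n / 4).
have y0 : 0 < y by rewrite powR_gt0// divr_gt0.
have X1 : 0 < 1 + X by rewrite ltr_wpDr.
pose eps := Num.min (1 + X)^-1 y.
have e0 : 0 < eps by rewrite lt_min invr_gt0 X1.
have eX : eps <= (1 + X)^-1 by rewrite ge_min lexx.
have ey : eps <= y by rewrite ge_min lexx orbT.
have Xi1 : (1 + X)^-1 <= 1 by rewrite invf_le1// lerDl.
have e1 : eps <= 1 := le_trans eX Xi1.
exists eps; first by rewrite e0.
split.
  have h : eps * (1 + X) <= 1 by rewrite -ler_pdivlMr// mul1r.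
  have : eps ^+ 2 <= eps by rewrite expr2 ler_piMr// ltW.
  move=> h2; apply: (@le_trans _ _ (X * eps)); first by rewrite ler_wpM2l.
  by lra.
have -> : eps `^ (1 + 4 / n) = eps * eps `^ (4 / n).
  by rewrite powRD ?powRr1 ?(ltW e0)// (gt_eqF e0) implybT.
have h : eps `^ (4 / n) <= c / Cd.
  apply: (@le_trans _ _ (y `^ (4 / n))).
    by apply: ge0_ler_powR; rewrite ?nnegrE ?divr_ge0 ?(ltW e0) ?(ltW y0) ?(ltW n0).
  rewrite /y -powRrM (_ : n / 4 * (4 / n) = 1); last by field; rewrite gt_eqF.
  by rewrite powRr1// divr_ge0// ltW.
rewrite mulrCA mulrC ler_pM2r//.
by move: h; rewrite ler_pdivlMr// mulrC.
Qed.

Lemma powR_succ_le (t a b : R) : 0 < t -> 0 <= b -> b <= a -> (1 + t) `^ (- a) <= t `^ (- b).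
Proof.
move=> t0 b0 ba; apply: (@le_trans _ _ ((1 + t) `^ (- b))).
  by apply: ler_powR; rewrite ?lerDl ?lerN2// ltW.
by apply: powR_neg_le => //; rewrite lerDr.
Qed.

Lemma Lnorm_le (mu : {measure set (N.-tuple R) -> \bar R}) (r C : R) (g : N.-tuple R -> R) :
  0 < r -> 0 <= C -> (\int[mu]_x (`|g x| `^ r)%:E <= (C `^ r)%:E)%E ->
  ('N[mu]_r%:E [EFin \o g] <= C%:E)%E.
Proof.
move=> r0 C0 h; rewrite unlock.
have -> : (\int[mu]_x `|(EFin \o g) x| `^ r = \int[mu]_x (`|g x| `^ r)%:E)%E.
  by apply: eq_integral => x _.
have i0 : (0 <= \int[mu]_x (`|g x| `^ r)%:E)%E.
  by apply: integral_ge0 => x _; rewrite lee_fin powR_ge0.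
case: (integral _ _ _) i0 h => [j| |]//; rewrite !lee_fin => j0 h.
have -> : C = (C `^ r) `^ r^-1 by rewrite -powRrM divff ?gt_eqF// powRr1.
by apply: ge0_ler_powR; rewrite ?nnegrE ?powR_ge0 ?invr_ge0// ltW.
Qed.

Lemma decay_rate_gt0 (l r : R) : 1 < l -> 0 < r -> n * (l - 1) / 2 < r ->
  0 < 1 / (l - 1) - n / (2 * r).
Proof.
move=> l1 r0 h; have l0 : 0 < l - 1 by rewrite subr_gt0.
have -> : 1 / (l - 1) - n / (2 * r) = (2 * r - n * (l - 1)) / (2 * r * (l - 1)).
  by field; rewrite !gt_eqF.
apply: divr_gt0; last by rewrite !mulr_gt0.
by move: h; rewrite ltr_pdivrMr//; lra.
Qed.

End decay_lemmas.

(** All constants are fixed before the data and the solution. The threshold is a/2 because the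
    infimum must be strictly below a for [u0] to lie in the ball of radius a. *)
Lemma small_data_class (R : realType) (N : nat)
  (mu : {measure set (N.-tuple R) -> \bar R})
  (l : R) (f : R -> R) (Cf lam P : R) :
  (0 < N)%N -> is_lebesgue_measure mu -> 1 + 4 / N%:R <= l -> 2 <= l ->
  f 0 = 0 -> 0 < Cf -> 0 < lam ->
  (forall u v : R, `|f u - f v| <=
     Cf * `|u - v| * (`|u| `^ (l - 1) * expR (lam * u ^+ 2) +
                      `|v| `^ (l - 1) * expR (lam * v ^+ 2))) ->
  2 * (N%:R + 4) <= P ->
  exists delta eps K a : R, [/\ 0 < delta, 0 < eps <= 1, 0 <= K &
    forall (u0 : N.-tuple R -> R) (u : R -> N.-tuple R -> R),
      in_expL2_0 mu u0 -> expL2_norm mu u0 <= delta ->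
      global_mild_solution mu f u0 u ->
      [/\ luxemburg_ball mu u0 a,
          forall t, 0 <= t -> small_class mu eps P (eps * decay_weight (N := N) t) (u t) &
          forall t, 0 < t ->
            {ae mu, forall x, `|u t x| <= `|heat mu t u0 x| + K * decay_weight (N := N) t}]].
Proof.
move=> N0 mu_leb ml l2 f0 Cf0 lam0 f_lip P_ge.
have mu_sf := lebesgue_sigma_finite mu_leb.
have [M M1 mass] := gauss_kernel_mass mu_leb N0.
have n1 : 1 <= N%:R :> R by rewrite ler1n.
pose k := lam + (l - (1 + 4 / N%:R)).
have k0 : 0 <= k by rewrite addr_ge0 ?subr_ge0// ltW.
have Cd0 := duhamel_const_gt0 (N := N) M1 Cf0 k0.
pose eta : R := (4 * 2 `^ (N%:R / 4))^-1.
have eta0 : 0 < eta by rewrite invr_gt0 mulr_gt0// powR_gt0.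
have eta40 : 0 < eta / 4 by rewrite divr_gt0.
pose X1 := 2 * (k * (2 * N%:R)); pose X2 := 2 * l - 3 + 2 * lam.
have X10 : 0 <= X1 by rewrite !mulr_ge0.
have X20 : 0 <= X2 by rewrite /X2; lra.
have [eps /andP[eps0 eps1] [eX eC]] := small_eps_exists N0 (addr_ge0 X10 X20) Cd0 eta40.
have e2 : 0 <= eps ^+ 2 by exact: sqr_ge0.
have eX1 : X1 * eps ^+ 2 <= 1.
  by apply: le_trans eX; apply: ler_wpM2r => //; rewrite lerDl.
have eX2 : X2 * eps ^+ 2 <= 1.
  by apply: le_trans eX; apply: ler_wpM2r => //; rewrite lerDr.
pose a := eta * eps / (4 * linear_const (N := N) M P).
have a0 : 0 < a.
  have [_ LM] := linear_const_ge N0 M1 P_ge.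
  have L0 : 0 < linear_const (N := N) M P by apply: lt_le_trans LM; lra.
  have h4 : (0 : R) < 4 by [].
  exact: (divr_gt0 (mulr_gt0 eta0 eps0) (mulr_gt0 h4 L0)).
pose K := duhamel_const (N := N) M Cf k * eps `^ (1 + 4 / N%:R).
exists (a / 2), eps, K, a; split.
- by rewrite divr_gt0.
- by rewrite eps0.
- exact: (mulr_ge0 (ltW Cd0) (powR_ge0 _ _)).
move=> u0 u u0E u0d [[uE uc] mild].
have mu0 : measurable_fun setT u0 := u0E.1.1.1.
have [b0 u0b] := in_expL2_ball u0E.1.
have u0a : luxemburg_ball mu u0 a.
  apply: (luxemburg_ball_norm mu0 u0b); apply: le_lt_trans u0d _.
  by rewrite ltr_pdivrMr// mulr_natr mulr2n ltrDl.
have um t : 0 <= t -> measurable_fun setT (u t) by move=> /uE[[[]]].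
have uc' t : 0 <= t -> forall e, 0 < e -> exists2 dl : R, 0 < dl &
    forall s, 0 <= s -> `|s - t| < dl -> luxemburg_ball mu (fun x => u s x - u t x) e.
  move=> t0 e e0; have [d d0 Hd] := uc t t0 e e0; exists d; first exact: d0.
  move=> s s0 st.
  have [b1 ub1] := in_expL2_ball (uE s s0).1.
  have [b2 ub2] := in_expL2_ball (uE t t0).1.
  have mN : measurable_fun setT (fun x => - u t x).
    by apply: measurableT_comp => //; exact: um.
  (* The difference lies in some ball, so its norm is a genuine infimum and its smallness is
     informative. *)
  have := luxemburg_ballD (um s s0) mN ub1 (luxemburg_ballN ub2) => lb.
  apply: (luxemburg_ball_norm _ lb); last exact: Hd.
  by apply: measurable_funB; exact: um.
split=> // t t0.
- exact: (bootstrap_class N0 mu_sf M1 mass P_ge ml l2 f0 Cf0 lam0 f_lip eps0 eps1 eX1 eX2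
    mu0 um uc' mild u0a eC t0).
- exact: (bootstrap_pointwise N0 mu_sf M1 mass P_ge ml l2 f0 Cf0 lam0 f_lip eps0 eps1 eX1 eX2
    mu0 um uc' mild u0a eC t0).
Qed.

Unset Implicit Arguments.

Theorem theorem1p5 (R : realType) (N : nat)
  (mu : {measure set (N.-tuple R) -> \bar R})
  (l : R) (f : R -> R) (Cf lam : R) :
  (0 < N)%N ->
  is_lebesgue_measure mu ->
  1 + 4 / N%:R <= l -> 2 <= l ->
  f 0 = 0 -> 0 < Cf -> 0 < lam ->
  (forall u v : R, `|f u - f v| <=
     Cf * `|u - v| * (`|u| `^ (l - 1) * expR (lam * u ^+ 2) +
                      `|v| `^ (l - 1) * expR (lam * v ^+ 2))) ->
  forall p : \bar R,
  (if (4 <= N)%N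
   then exists2 r : R, p = r%:E :> \bar R & (N%:R * (l - 1) / 2 < r)%R
   else (Num.max l (2 * N%:R * (l - 1) / (4 - N%:R)))%:E <= p)%E ->
  let sigma := decay_rate N l p in
  0 < sigma /\
  exists2 delta : R, 0 < delta &
    forall (u0 : N.-tuple R -> R) (u : R -> N.-tuple R -> R),
      in_expL2_0 mu u0 -> expL2_norm mu u0 <= delta ->
      global_mild_solution mu f u0 u ->
      exists2 C : R, 0 < C &
        forall t : R, 0 < t -> ('N[mu]_p [EFin \o u t] <= (C * t `^ (- sigma))%:E)%E.
Proof.
move=> N0 mu_leb ml l2 f0 Cf0 lam0 f_lip p hp sigma.
have n1 : 1 <= N%:R :> R by rewrite ler1n.
have n0 : 0 < N%:R :> R by lra.
have l0 : 0 < l - 1 by lra.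
have nl4 : 4 <= N%:R * (l - 1).
  have : 4 / N%:R <= l - 1 by lra.
  by rewrite ler_pdivrMr// mulrC.
have sl : 1 / (l - 1) <= N%:R / 4 by rewrite ler_pdivrMr// mulrAC ler_pdivlMr//; lra.
(* Since 4 - N < 4, the lower bound on p for N < 4 exceeds N(l-1)/2, the value at which sigma
   vanishes. *)
have small4 : (N < 4)%N -> N%:R * (l - 1) / 2 < 2 * N%:R * (l - 1) / (4 - N%:R).
  move=> N4; have n4 : N%:R < 4 :> R by rewrite (ltr_nat R N 4).
  have d0 : 0 < 4 - N%:R :> R by lra.
  rewrite ltr_pdivlMr//; nra.
case: p hp @sigma => [r| |] hp sigma.
- have [r2 rlow] : 2 <= r /\ N%:R * (l - 1) / 2 < r.
    move: hp; case: (leqP 4 N) => N4.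
      by case=> r' [<-] h; split=> //; lra.
    rewrite lee_fin ge_max => /andP[lr h]; split; first lra.
    exact: lt_le_trans (small4 N4) h.
  have l1 : 1 < l by lra.
  have r0 : 0 < r by lra.
  have s0 : 0 < sigma by exact: decay_rate_gt0.
  split=> //.
  pose P := Num.max r (2 * (N%:R + 4)).
  have rP : r <= P by rewrite le_max lexx.
  have P_ge : 2 * (N%:R + 4) <= P by rewrite le_max lexx orbT.
  have [dl [eps [K [a [dl0 /andP[eps0 eps1] K0 H]]]]] :=
    small_data_class N0 mu_leb ml l2 f0 Cf0 lam0 f_lip P_ge.
  (* The constant 2 suffices, because eps <= 1 gives 2 eps^2 <= 2 <= 2^r. *)
  exists dl => // u0 u u0E u0d usol; exists 2 => // t t0.
  have [_ uQ _] := H u0 u u0E u0d usol.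
  have C0 : 0 <= 2 * t `^ (- sigma) by rewrite mulr_ge0 ?powR_ge0.
  apply: Lnorm_le => //.
  have W0 := decay_weight_gt0 (N := N) (ltW t0).
  have w0 : 0 < eps * decay_weight (N := N) t by rewrite mulr_gt0.
  apply: le_trans (class_Lq eps0 w0 (uQ t (ltW t0)) r2 rP) _.
  rewrite lee_fin [leRHS]powRM ?powR_ge0//.
  have e1 : 2 * eps `^ 2 <= 2 `^ r.
    apply: (@le_trans _ _ 2); last by apply: le1r_powR; rewrite ?ler1n//; lra.
    by rewrite ler_piMr// powR_mulrn ?(ltW eps0)// expr_le1// ltW.
  apply: ler_pM; [by rewrite mulr_ge0 ?powR_ge0|exact: powR_ge0|exact: e1|].
  apply: (@le_trans _ _ (decay_weight (N := N) t `^ (r - 2))).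
    apply: ge0_ler_powR; rewrite ?nnegrE ?(ltW w0) ?(ltW W0)//; first by lra.
    by rewrite ler_piMl// ltW.
  (* The available exponent is r N/4 - N/2 and the required one is sigma r = r/(l-1) - N/2; they
     compare by 1/(l-1) <= N/4. *)
  rewrite /decay_weight -powRrM -powRrM !mulNr; apply: powR_succ_le => //.
    by rewrite mulr_ge0 ?(ltW s0) ?(ltW r0).
  rewrite /sigma /= mulrBl (_ : N%:R / (2 * r) * r = N%:R / 2); last by field; rewrite gt_eqF.
  have := ler_wpM2r (ltW r0) sl; lra.
- have N4 : (N < 4)%N by move: hp; case: (leqP 4 N) => // _ [].
  have s0 : 0 < sigma by rewrite divr_gt0.
  split=> //.
  have [M M1 mass] := gauss_kernel_mass mu_leb N0.
  have [dl [eps [K [a [dl0 /andP[eps0 eps1] K0 H]]]]] :=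
    small_data_class N0 mu_leb ml l2 f0 Cf0 lam0 f_lip (lexx _).
  exists dl => // u0 u u0E u0d usol.
  have [u0a _ uae] := H u0 u u0E u0d usol.
  have [a0 _] := u0a.
  have mu0 : measurable_fun setT u0 := u0E.1.1.1.
  (* For t <= 1 the linear part may blow up no faster than t^(-1/(l-1)), which the L^q bound ensures
     as N/(2q) <= 1/(l-1). For t > 1 the L^2 bound decays like t^(-N/4), which is at least as fast
     as required. *)
  pose q := Num.max 2 (N%:R * (l - 1) / 2).
  pose A (s : R) := s `^ 2^-1 * a.
  have A0 s : 0 <= A s by rewrite mulr_ge0 ?powR_ge0 ?(ltW a0).
  have hA s x t : 2 <= s -> 0 < t -> `|heat mu t u0 x| <= M * t `^ (- (N%:R / (2 * s))) * A s.
    move=> s2 t0; apply: heat_Linfty => //; first lra.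
    apply: le_trans (luxemburg_Lq mu0 u0a s2) _.
    by rewrite lee_fin /A powRM ?powR_ge0 ?(ltW a0)// -powRrM [s / 2]mulrC.
  have q2 : 2 <= q by rewrite le_max lexx.
  have sq : N%:R / (2 * q) <= sigma.
    have nq : N%:R * (l - 1) / 2 <= q by rewrite le_max lexx orbT.
    have q0 : 0 < 2 * q by lra.
    rewrite /sigma /= (ler_pdivrMr _ _ q0) mulrAC mul1r ler_pdivlMr//; lra.
  have M0 : 0 <= M by lra.
  have C0 : 0 <= M * A 2 + M * A q + K.
    exact: (addr_ge0 (addr_ge0 (mulr_ge0 M0 (A0 2)) (mulr_ge0 M0 (A0 q))) K0).
  exists (M * A 2 + M * A q + K + 1) => [|t t0]; first by rewrite ltr_wpDl.
  rewrite unlock; case: ifPn => _; last first.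
    by rewrite lee_fin mulr_ge0 ?powR_ge0// addr_ge0.
  apply/ess_sup_inf.ess_supP; have := uae t t0; apply: filterS => x ux.
  rewrite /= lee_fin; apply: le_trans ux _.
  have T0 : 0 <= t `^ (- sigma) by exact: powR_ge0.
  have hW : decay_weight (N := N) t <= t `^ (- sigma) by apply: powR_succ_le => //; exact: ltW.
  have hH : `|heat mu t u0 x| <= (M * A 2 + M * A q) * t `^ (- sigma).
    have MA s : 0 <= M * A s by exact: (mulr_ge0 M0 (A0 s)).
    have hs s : 2 <= s -> t `^ (- (N%:R / (2 * s))) <= t `^ (- sigma) ->
        `|heat mu t u0 x| <= M * A s * t `^ (- sigma).
      move=> s2 ts; apply: le_trans (hA s x t s2 t0) _.
      by rewrite mulrAC ler_wpM2l.
    rewrite mulrDl; have [t1|t1] := leP t 1.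
      apply: le_trans (hs q q2 _) _; last by rewrite lerDr mulr_ge0.
      by apply: ger_powR; rewrite ?t0// lerN2.
    apply: le_trans (hs 2 (lexx _) _) _; last by rewrite lerDl mulr_ge0.
    apply: ler_powR; first exact: ltW.
    by rewrite lerN2; apply: le_trans sl _; lra.
  have hK := ler_wpM2l K0 hW.
  rewrite !mulrDl mul1r in hH *; lra.
- by move: hp; case: (leqP 4 N) => // _ [].
Qed.
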